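(* Fix $\alpha\in[0,\infty)$ and consider the random graph $\mathscr{G}(n,\alpha/n)$. For $r\ge 0$ let $\mathscr{V}_r$ denote the (random) set of vertices that belong to connected components having more than $r$ vertices. Then for every $\varrho\in[0,1]$, \[ \lim_{\epsilon\downarrow0}\ \lim_{n\to\infty}\ P_{n,\alpha}\bigl(|\mathscr{V}_{\epsilon n}|=\lfloor\varrho n\rfloor\bigr)^{1/n}=\mathrm{e}^{-\Phi(\varrho,\alpha)}, \] where \[ \Phi(\varrho,\alpha)=S(\varrho)-\varrho\log\pi_1(\alpha\varrho)-(1-\varrho)\log\bigl[1-\pi_1(\alpha\varrho)\bigr]-(1-\varrho)\Psi\bigl(\alpha(1-\varrho)\bigr). \]
   Context: $\mathscr{G}(n,p)$ is the random graph on vertex set $\{1,\dots,n\}$ in which each of the $\binom n2$ unordered pairs $\{k,l\}$ is an edge independently with probability $p$; here $p=\alpha/n$ (with $n>\alpha$), and $P_{n,\alpha}$ is the corresponding probability measure. The size of a component is its number of vertices. Notation: $S(\varrho)=\varrho\log\varrho+(1-\varrho)\log(1-\varrho)$; $\pi_1(x)=1-\mathrm{e}^{-x}$; $\Psi(x)=\bigl(\log x-\tfrac12[x-\tfrac1x]\bigr)\wedge 0$ for $x>0$ and $\Psi(0)=0$ (note $\Psi(x)<0$ iff $x>1$). Conventions: $0\log 0=0$, $\log 0=-\infty$ otherwise, $\mathrm{e}^{-\infty}=0$. *)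

(* Defs.v *)
From HB Require Import structures.
From mathcomp Require Import all_boot all_order all_algebra.
From mathcomp Require Import all_classical all_reals all_analysis.
Set Implicit Arguments. Unset Strict Implicit. Unset Printing Implicit Defensive.
Import Order.TTheory GRing.Theory Num.Theory.
Local Open Scope ring_scope.

Section RandomGraph.
Variable R : realType.

(* Unordered pairs {k,l} of 'I_n are encoded as ordered pairs (k,l) with k < l. *)
Definition pairs (n : nat) : {set 'I_n * 'I_n} := [set x : 'I_n * 'I_n | (val x.1 < val x.2)%N].

(* A graph on vertex set 'I_n is an edge set E \subset pairs n. *)
Definition adj (n : nat) (E : {set 'I_n * 'I_n}) : rel 'I_n :=
  fun i j => ((i, j) \in E) || ((j, i) \in E).

Definition comp (n : nat) (E : {set 'I_n * 'I_n}) (v : 'I_n) : {set 'I_n} :=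
  [set w | connect (adj E) v w].

Definition Vset (n : nat) (E : {set 'I_n * 'I_n}) (r : R) : {set 'I_n} :=
  [set v | r < (#|comp E v|)%:R].

Definition graph_weight (n : nat) (p : R) (E : {set 'I_n * 'I_n}) : R :=
  p ^+ #|E| * (1 - p) ^+ (#|pairs n| - #|E|).

Definition Pna (n : nat) (alpha : R) (A : pred {set 'I_n * 'I_n}) : R :=
  \sum_(E : {set 'I_n * 'I_n} | (E \subset pairs n) && A E)
     graph_weight (alpha / n%:R) E.

Definition xlnx (x : R) : R := if x == 0 then 0 else x * ln x.

(* x log y (x, y >= 0) in extended reals, with 0 log 0 = 0 and log 0 = -oo *)
Definition xlny (x y : R) : \bar R :=
  if x == 0 then 0%E else if y == 0 then (-oo)%E else (x * ln y)%:E.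

Definition Sent (rho : R) : R := xlnx rho + xlnx (1 - rho).

Definition pi1 (x : R) : R := 1 - expR (- x).

Definition Psi (x : R) : R :=
  if x == 0 then 0 else Num.min (ln x - 2^-1 * (x - x^-1)) 0.

Definition Phi (rho alpha : R) : \bar R :=
  ((Sent rho)%:E - xlny rho (pi1 (alpha * rho))
   - xlny (1 - rho) (1 - pi1 (alpha * rho))
   - ((1 - rho) * Psi (alpha * (1 - rho)))%:E)%E.

Definition expNE (x : \bar R) : R :=
  match x with
  | EFin r => expR (- r)
  | _ => 0 (* Phi = +oo gives e^{-oo} = 0; Phi is never -oo *)
  end.

Definition seq_eps (alpha rho eps : R) (n : nat) : R :=
  powR (@Pna n alpha (fun E => (#|Vset E (eps * n%:R)|)%:Z == Num.floor (rho * n%:R)))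
       (n%:R^-1).

End RandomGraph.

(* Main.v *)
(** Let [q = 1 - alpha / n].  Conditioning on the component of a fixed vertex, the probability [Q_m]
    that all component sizes of a graph on [m] vertices lie in a set [S] satisfies
    [Q_m = sum_(k in S) C(m-1, k-1) C_k q^(k (m-k)) Q_(m-k)], where [C_k] is the probability that
    [k] vertices are connected; [S = everything] gives [Q_m = 1], which determines [C_k].  Hence the
    event of the theorem has probability [C(n, k) q^(k (n-k)) Q_k(> eps n) Q_(n-k)(<= eps n)] with
    [k = floor (rho n)].

    Exploring the graph layer by layer gives the recursion of [reach] below, and the binomial theorem
    turns it into [(1 - q^k)^(k-1) / k <= C_k <= (1 - q^k)^(k-1)].  Together with
    [C(m, k) a^k b^(m-k) <= (a + b)^m] this shows that [Q_k(> eps n)] is [C_k] up to a subexponential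
    factor.

    For [Q_m(<= eps n)] as [eps] tends to [0], the upper bound is an exponential supersolution of the
    recursion above the critical size [n / alpha] (the mass of the component sizes at criticality is
    one), glued to the trivial bound below that size; the lower bound removes components of size
    [eps n] until the graph is subcritical, where Markov's inequality for the mean component size
    suffices.  For fixed [eps] the limit is not explicit: splitting off the components with sizes in
    [(delta n, eps n]] and using the two bounds for [delta] shows that the largest exponential lower
    bound is also an upper bound. *)

From HB Require Import structures.
From mathcomp Require Import all_boot all_order all_algebra.
From mathcomp Require Import reals.
From mathcomp Require Import ring lra zify.
Require Import Defs.
Set Implicit Arguments. Unset Strict Implicit. Unset Printing Implicit Defensive.
Import Order.TTheory GRing.Theory Num.Theory.
Local Open Scope ring_scope.

(** * Layer-by-layer exploration *)

(** The shape of the answer comes from one function. The weight [gam m], which absorbs the binomial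
    coefficients and the cross factors [q^(k (m - k))], has exponential order [- gfun u] at
    [m = u n]. For [alpha > 0] this function of [u] is concave up to [1 / alpha] and convex beyond;
    the inflection point is the critical size. Graphs without large components follow [- gfun] up to
    the inflection and then its tangent line there, of slope [1 + ln alpha]. The tangent minus
    [- gfun] is [fcrit], the origin of [Psi] and of its truncation at [0]. The weight of a connected
    piece of [y n] vertices has order [phi y], whose slope at [0] is again [1 + ln alpha]: removing
    pieces of size [delta n] moves along the tangent at a cost that vanishes with [delta], which is
    why the lower bound meets the upper one. Factors polynomial in [n] are lost everywhere, so the
    factor [k] between the two bounds on [C_k] is harmless. Both [ln alpha] and [1 / alpha] occur
    throughout, so [alpha = 0] is a separate case. *)

Lemma sum_triangle (V : nmodType) (m : nat) (F : nat -> nat -> V) :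
  \sum_(j < m.+1) \sum_(i < j.+1) F i (j - i)%N =
  \sum_(i < m.+1) \sum_(l < (m - i).+1) F i l.
Proof.
under eq_bigr => j _.
  rewrite (big_ord_widen m.+1 (fun i => F i (j - i)%N)) ?ltn_ord //; over.
rewrite (exchange_big_dep xpredT) //=; apply: eq_bigr => i _.
rewrite -(big_mkord (fun j => (i < j.+1)%N) (fun j => F i (j - i)%N)).
rewrite (big_cat_nat (n := i)) //=; last by rewrite ltnW.
rewrite [X in X + _]big_nat_cond [X in X + _]big1 ?add0r; last first.
  by move=> j; lia.
rewrite -{1}[nat_of_ord i]add0n big_addn subSn; last by rewrite -ltnS.
rewrite big_mkord big_mkcond /=.
by apply: eq_bigr => l _; rewrite ltnS leq_addl addnK.
Qed.

Lemma bin_mul_sub (m i l : nat) : (i + l <= m)%N ->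
  ('C(m, i + l) * 'C(i + l, i) = 'C(m, i) * 'C(m - i, l))%N.
Proof.
move=> h; apply/eqP.
have e1 := bin_fact h; have e2 := bin_fact (leq_addr l i).
have e3 : (i <= m)%N by lia. have {}e3 := bin_fact e3.
have e4 : (l <= m - i)%N by lia. have {}e4 := bin_fact e4.
rewrite addKn in e2.
have e0 : (m - (i + l) = m - i - l)%N by lia.
rewrite e0 in e1.
have f0 : (0 < i`! * l`! * (m - i - l)`!)%N by rewrite !muln_gt0 !fact_gt0.
rewrite -(eqn_pmul2r f0); apply/eqP.
transitivity m`!; first by rewrite -e1 -e2; ring.
by rewrite -e3 -e4; ring.
Qed.

Section Binomial.
Variable R : numFieldType.
Implicit Types a b : R.

Lemma binom_sum a b (m : nat) :
  \sum_(j < m.+1) 'C(m, j)%:R * a ^+ j * b ^+ (m - j) = (a + b) ^+ m.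
Proof.
rewrite addrC exprDn; apply: eq_bigr => j _.
by rewrite -mulr_natl; ring.
Qed.

Lemma binom_mean a b (m : nat) :
  \sum_(j < m.+2) 'C(m.+1, j)%:R * a ^+ j * b ^+ (m.+1 - j) * j%:R =
  m.+1%:R * a * (a + b) ^+ m.
Proof.
rewrite big_ord_recl /= mulr0 add0r -binom_sum mulr_sumr; apply: eq_bigr => j _.
rewrite /bump /= add1n subSS exprS.
have := mul_bin_diag m.+1 j => /= /(congr1 (fun k => k%:R : R)).
rewrite !natrM => e.
by transitivity (j.+1%:R * 'C(m.+1, j.+1)%:R * (a * a ^+ j * b ^+ (m - j)));
  [ring | rewrite -e; ring].
Qed.

Lemma binom_term_le a b (m k : nat) : 0 <= a -> 0 <= b -> (k <= m)%N ->
  'C(m, k)%:R * a ^+ k * b ^+ (m - k) <= (a + b) ^+ m.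
Proof.
move=> a0 b0 lkm; have hk : (k < m.+1)%N by lia.
rewrite -binom_sum (bigD1 (Ordinal hk)) //= lerDl sumr_ge0 // => i _.
by rewrite !mulr_ge0 ?exprn_ge0.
Qed.

End Binomial.

Section Reach.
Variables (R : realFieldType) (q : R).

(* [reach s m] is the probability that every one of [m] vertices is reached from [s] sources; the
   summation index [j] counts the vertices adjacent to a source, which are the sources of the next
   layer. *)
Fixpoint reach_fuel (f s m : nat) : R :=
  match m, f with
  | 0, _ => 1
  | _, 0 => 0
  | m'.+1, f'.+1 =>
    \sum_(j < m'.+1) 'C(m'.+1, j.+1)%:R * (1 - q ^+ s) ^+ j.+1
      * q ^+ (s * (m' - j)) * reach_fuel f' j.+1 (m' - j)
  end.

(** Every nonempty layer uses up a vertex, so fuel [m] never runs out. *)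
Definition reach (s m : nat) : R := reach_fuel m s m.

Lemma reach_fuelE f s m : (m <= f)%N -> reach_fuel f s m = reach s m.
Proof.
elim/ltn_ind: f s m => f IH s [|m]; first by case: f {IH} => [|f].
case: f IH => // f IH lemf; rewrite /reach /=; apply: eq_bigr => j _; congr (_ * _).
have h : (m - j <= m)%N by lia.
rewrite IH //; last lia.
by rewrite [RHS]IH //; lia.
Qed.

Lemma reach0r s : reach s 0 = 1. Proof. by []. Qed.

Lemma reachS s m : reach s m.+1 =
  \sum_(j < m.+1) 'C(m.+1, j.+1)%:R * (1 - q ^+ s) ^+ j.+1
      * q ^+ (s * (m - j)) * reach j.+1 (m - j).
Proof. by apply: eq_bigr => j _; congr (_ * _); apply: reach_fuelE; lia. Qed.

Lemma reach0S m : reach 0 m.+1 = 0.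
Proof.
by rewrite reachS big1 // => j _; rewrite expr0 subrr expr0n /= mulr0 !mul0r.
Qed.

(** The added term [j = 0], an empty next layer, vanishes for [m > 0] and is [1] for [m = 0]; with
    it the sum runs over a full binomial distribution. *)
Lemma reach_rec s m : reach s m =
  \sum_(j < m.+1) 'C(m, j)%:R * (1 - q ^+ s) ^+ j * q ^+ (s * (m - j))
     * reach j (m - j).
Proof.
case: m => [|m].
  by rewrite big_ord1 /= bin0 expr0 muln0 expr0 !mulr1 reach0r.
rewrite big_ord_recl /= reach0S mulr0 add0r reachS; apply: eq_bigr => j _.
by rewrite /bump /= add1n subSS.
Qed.

(** Probability that exactly [j] of [m] vertices are reached from [s] sources: the power of [q]
    excludes edges from the [s + j] vertices to the others. *)
Definition reach_law s m j : R := 'C(m, j)%:R * reach s j * q ^+ ((s + j) * (m - j)).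

(** Conditioning on the first layer: of the [j] reached vertices, [i] are adjacent to a source and
    the other [l] are reached from these [i] alone. The [m - i] vertices outside the first layer
    miss all [s] sources, whence the power of [q]. *)
Lemma sum_reach_law s m (h : nat -> R) :
  \sum_(j < m.+1) reach_law s m j * h j =
  \sum_(i < m.+1) 'C(m, i)%:R * (1 - q ^+ s) ^+ i * q ^+ (s * (m - i)) *
     \sum_(l < (m - i).+1) reach_law i (m - i) l * h (i + l)%N.
Proof.
pose F i l := 'C(m, i)%:R * (1 - q ^+ s) ^+ i * q ^+ (s * (m - i)) *
     (reach_law i (m - i) l * h (i + l)%N).
under [RHS]eq_bigr => i _ do rewrite mulr_sumr.
rewrite -(sum_triangle m F); apply: eq_bigr => j _.
rewrite /reach_law reach_rec mulr_sumr !mulr_suml; apply: eq_bigr => i _.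
have lij : (i <= j)%N by rewrite -ltnS.
have ljm : (j <= m)%N by rewrite -ltnS.
rewrite /F /reach_law subnKC //.
have := @bin_mul_sub m i (j - i); rewrite subnKC // => /(_ ljm).
move=> /(congr1 (fun k => k%:R : R)); rewrite !natrM => e.
have -> : (s * (m - i) = s * (j - i) + s * (m - j))%N by nia.
have -> : (m - i - (j - i) = m - j)%N by lia.
rewrite mulnDl !exprD.
transitivity (('C(m, j)%:R * 'C(j, i)%:R) * ((1 - q ^+ s) ^+ i *
  q ^+ (s * (j - i)) * reach i (j - i) * (q ^+ (s * (m - j)) * q ^+ (j * (m - j))) * h j)).
  by ring.
by rewrite e; ring.
Qed.

Lemma reach_law_sum s m : \sum_(j < m.+1) reach_law s m j = 1.
Proof.
elim/ltn_ind: m s => m IH s.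
under eq_bigr => j _ do rewrite -[reach_law _ _ _]mulr1.
rewrite (sum_reach_law s m (fun=> 1)).
transitivity ((1 - q ^+ s + q ^+ s) ^+ m); last by rewrite subrK expr1n.
rewrite -binom_sum; apply: eq_bigr => i _.
rewrite exprM -[RHS]mulr1; congr (_ * _).
under eq_bigr => l _ do rewrite mulr1.
(* With an empty first layer the number of vertices does not drop and the induction hypothesis is of
   no help; then only [l = 0] contributes. *)
case: i => -[|i] /= lim; last by rewrite IH //; lia.
rewrite big_ord_recl big1 ?addr0 => [|l _].
  by rewrite /reach_law bin0 mul0n expr0 reach0r !mulr1.
by rewrite /reach_law lift0 reach0S mulr0 mul0r.
Qed.

Hypotheses (q_ge0 : 0 <= q) (q_le1 : q <= 1).

Let q1 k : 0 <= 1 - q ^+ k. Proof. by rewrite subr_ge0 exprn_ile1. Qed.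

Lemma reach_ge0 s m : 0 <= reach s m.
Proof.
elim/ltn_ind: m s => -[|m] IH s; first by rewrite reach0r.
rewrite reachS sumr_ge0 // => j _.
by rewrite !mulr_ge0 ?exprn_ge0 ?IH //; lia.
Qed.

Lemma reach_law_ge0 s m j : 0 <= reach_law s m j.
Proof. by rewrite !mulr_ge0 ?exprn_ge0 ?reach_ge0. Qed.

(** The base splits as [(1 - q^s) + q^s (1 - q^m)]: a vertex meets the sources, or misses them.
    Since [j + (m - j) = m], the induction hypothesis has the base [1 - q^m] for every layer size
    [j], and the binomial theorem closes the induction. *)
Lemma reach_le s m : reach s m <= (1 - q ^+ (s + m)) ^+ m.
Proof.
elim/ltn_ind: m s => m IH s; case: m IH => [|m] IH; first by rewrite reach0r expr0.
rewrite reach_rec.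
have -> : 1 - q ^+ (s + m.+1) = 1 - q ^+ s + q ^+ s * (1 - q ^+ m.+1).
  by rewrite exprD; ring.
rewrite -binom_sum; apply: ler_sum => j _.
rewrite exprMn -exprM [X in _ <= X]mulrA ler_wpM2l ?mulr_ge0 ?exprn_ge0 //.
case: j => -[|j] /= ljm; first by rewrite reach0S exprn_ge0.
by apply: le_trans (IH _ _ _) _; [lia | rewrite subnKC].
Qed.

(* Concavity of [k |-> 1 - q^k] in the integer [k]. *)
Lemma one_sub_exp_ratio s m : s%:R * (1 - q ^+ (s + m)) <= (s + m)%:R * (1 - q ^+ s).
Proof.
have key k : k%:R * (1 - q ^+ k.+1) <= k.+1%:R * (1 - q ^+ k).
  elim: k => [|k IH]; first by rewrite mul0r expr0 subrr mulr0.
  have e j : (j.+1%:R * (1 - q ^+ j) - j%:R * (1 - q ^+ j.+1)) =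
       1 + j%:R * q ^+ j.+1 - j.+1%:R * q ^+ j by rewrite -natr1; ring.
  have : 0 <= 1 + k%:R * q ^+ k.+1 - k.+1%:R * q ^+ k by rewrite -e subr_ge0.
  move=> IH'; rewrite -subr_ge0 e.
  have -> : 1 + k.+1%:R * q ^+ k.+2 - k.+2%:R * q ^+ k.+1 =
     q * (1 + k%:R * q ^+ k.+1 - k.+1%:R * q ^+ k) + (1 - q) * (1 - q ^+ k.+1).
    by rewrite !exprS -!natr1; ring.
  by rewrite addr_ge0 ?mulr_ge0 // subr_ge0.
elim: m => [|m IH]; first by rewrite addn0.
case: s IH key => [|s] IH key; first by rewrite mul0r mulr_ge0.
have p0 : (0 : R) < (s.+1 + m)%:R by rewrite ltr0n.
rewrite -(ler_pM2l p0) mulrCA.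
apply: le_trans (_ : s.+1%:R * ((s.+1 + m).+1%:R * (1 - q ^+ (s.+1 + m))) <= _).
  by rewrite addnS ler_wpM2l // key.
by rewrite mulrCA [leRHS]mulrCA addnS ler_wpM2l.
Qed.

(** The factor [s / (s + m)], as in Cayley's count [s (s + m)^(m - 1)] of forests with [s]
    prescribed roots, survives the induction: for a layer of size [j] the hypothesis carries a
    factor [j], so the sum becomes a binomial mean, and the concavity of [1 - q^k] restores the
    factor for [s]. *)
Lemma reach_ge s m : s%:R * (1 - q ^+ (s + m)) ^+ m <= (s + m)%:R * reach s m.
Proof.
elim/ltn_ind: m s => m IH s; case: m IH => [|m] IH.
  by rewrite reach0r expr0 addn0.
have -> : reach s m.+1 = \sum_(j < m.+2) 'C(m.+1, j)%:R * (1 - q ^+ s) ^+ j *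
   q ^+ (s * (m.+1 - j)) * reach j (m.+1 - j) by rewrite reach_rec.
have h : (1 - q ^+ s) * (1 - q ^+ (s + m.+1)) ^+ m <=
   \sum_(j < m.+2) 'C(m.+1, j)%:R * (1 - q ^+ s) ^+ j *
   q ^+ (s * (m.+1 - j)) * reach j (m.+1 - j).
  have m0 : (0 : R) < m.+1%:R by rewrite ltr0n.
  rewrite -(ler_pM2l m0) mulrA.
  have -> : 1 - q ^+ (s + m.+1) = 1 - q ^+ s + q ^+ s * (1 - q ^+ m.+1).
    by rewrite exprD; ring.
  rewrite -binom_mean mulr_sumr; apply: ler_sum => j _.
  rewrite exprMn -exprM -!mulrA [leRHS]mulrCA ler_wpM2l //.
  rewrite [leRHS]mulrCA ler_wpM2l ?exprn_ge0 // [leRHS]mulrCA ler_wpM2l ?exprn_ge0 //.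
  case: j => -[|j] /= ljm; first by rewrite mulr0 reach0S mulr0.
  rewrite mulrC; have := IH (m.+1 - j.+1)%N _ j.+1.
  by rewrite subnKC //; apply; lia.
rewrite exprS mulrA.
apply: le_trans (_ : (s + m.+1)%:R * (1 - q ^+ s) * (1 - q ^+ (s + m.+1)) ^+ m <= _).
  by rewrite ler_wpM2r ?exprn_ge0 // one_sub_exp_ratio.
by rewrite -mulrA ler_wpM2l.
Qed.

Lemma one_sub_exp_le k : 1 - q ^+ k <= k%:R * (1 - q).
Proof.
elim: k => [|k IH]; first by rewrite expr0 subrr mul0r.
have := mulr_ge0 (q1 k) (q1 1); rewrite expr1 exprS -natr1 => h; lra.
Qed.

(** Comparison with a subcritical branching process: each vertex has at most [m (1 - q)] expected
    offspring, and the bound is [s] times the geometric series of the generations. *)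
Lemma reach_law_mean s m : m%:R * (1 - q) < 1 ->
  \sum_(j < m.+1) reach_law s m j * j%:R <= s%:R * (m%:R * (1 - q) / (1 - m%:R * (1 - q))).
Proof.
set B := fun m => m%:R * (1 - q) / (1 - m%:R * (1 - q)).
have p0 : 0 <= 1 - q by have := q1 1; rewrite expr1.
have mono i m' : (i <= m')%N -> m'%:R * (1 - q) < 1 -> B i <= B m'.
  move=> lim lm; rewrite /B.
  have lm' : i%:R * (1 - q) <= m'%:R * (1 - q) by rewrite ler_wpM2r // ler_nat.
  rewrite ler_pM ?mulr_ge0 // ?invr_ge0; first by lra.
  by rewrite lef_pV2 ?posrE; lra.
elim/ltn_ind: m s => m IH s lm.
rewrite (sum_reach_law s m (fun j => j%:R)).
have d0 : 0 < 1 - m%:R * (1 - q) by rewrite subr_gt0.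
(* A first layer of size [i] counts [i] itself and at most [i B(m)] later vertices, where
   [1 + B(m) = 1 / (1 - m (1 - q))]. *)
apply: le_trans (_ : \sum_(i < m.+1) 'C(m, i)%:R * (1 - q ^+ s) ^+ i * q ^+ s ^+ (m - i) *
     i%:R * (1 - m%:R * (1 - q))^-1 <= _).
  apply: ler_sum => i _; rewrite -exprM -[X in _ <= X]mulrA ler_wpM2l ?mulr_ge0 ?exprn_ge0 //.
  under eq_bigr => l _ do rewrite natrD mulrDr.
  rewrite big_split /= -mulr_suml reach_law_sum mul1r.
  case: i => -[|i] /= lim.
    rewrite mul0r add0r big1 // => -[[|l] hl] _; first by rewrite mulr0.
    by rewrite /reach_law reach0S mulr0 !mul0r.
  have lmi : (m - i.+1)%:R * (1 - q) < 1.
    by apply: le_lt_trans lm; rewrite ler_wpM2r // ler_nat; lia.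
  apply: le_trans (lerD (lexx _) (IH _ _ i.+1 lmi)) _; first lia.
  apply: le_trans (lerD (lexx _) (ler_wpM2l _ (mono _ m _ lm))) _ => //; first lia.
  rewrite /B -[X in X + _]mulr1 -mulrDr ler_wpM2l //.
  rewrite -[X in X + _](divff (lt0r_neq0 d0)) -mulrDl subrK mul1r //.
rewrite -mulr_suml; case: m lm d0 {IH} => [|m] lm d0.
  by rewrite big_ord1 /= mulr0 !mul0r mulr0.
rewrite binom_mean subrK expr1n mulr1 [leRHS]mulrA.
apply: ler_wpM2r; first by rewrite invr_ge0 ltW.
rewrite mulrCA ler_wpM2l //.
by apply: le_trans (one_sub_exp_le s) _; rewrite mulrC.
Qed.

End Reach.

(** * Probability of prescribed component sizes *)

Lemma bin2D a b : 'C(a + b, 2) = ('C(a, 2) + 'C(b, 2) + a * b)%N.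
Proof.
elim: a => [|a IH]; first by rewrite add0n bin0n mul0n addn0.
by rewrite addSn !binS IH !bin1; ring.
Qed.

Section ComponentSizes.
Variables (R : realFieldType) (q : R).

(* [cprob S m] is the probability that all component sizes of the random graph on [m] vertices lie
   in [S]; [k.+1] is the size of the component of a fixed vertex. *)
Fixpoint cprob_fuel (S : pred nat) (f m : nat) : R :=
  match m, f with
  | 0, _ => 1
  | _, 0 => 0
  | m'.+1, f'.+1 =>
    \sum_(k < m'.+1 | S k.+1) reach_law q 1 m' k * cprob_fuel S f' (m' - k)
  end.

Definition cprob (S : pred nat) (m : nat) : R := cprob_fuel S m m.

Lemma cprob_fuelE S f m : (m <= f)%N -> cprob_fuel S f m = cprob S m.
Proof.
elim/ltn_ind: f m => f IH [|m]; first by case: f {IH} => [|f].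
case: f IH => // f IH lemf; rewrite /cprob /=; apply: eq_bigr => j _; congr (_ * _).
have h : (m - j <= m)%N by lia.
rewrite IH //; last lia.
by rewrite [RHS]IH //; lia.
Qed.

Lemma cprob0 S : cprob S 0 = 1. Proof. by []. Qed.

Lemma cprobS S m : cprob S m.+1 =
  \sum_(k < m.+1 | S k.+1) reach_law q 1 m k * cprob S (m - k).
Proof. by apply: eq_bigr => j _; congr (_ * _); apply: cprob_fuelE; lia. Qed.

Lemma cprobT m : cprob xpredT m = 1.
Proof.
elim/ltn_ind: m => -[|m] IH; first by rewrite cprob0.
rewrite cprobS -[RHS](reach_law_sum q 1 m); apply: eq_bigr => k _.
by rewrite IH ?mulr1 //; lia.
Qed.

Hypotheses (q_gt0 : 0 < q) (q_le1 : q <= 1).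

Let q_ge0 := ltW q_gt0.
Let q1 k : 0 <= 1 - q ^+ k. Proof. by rewrite subr_ge0 exprn_ile1. Qed.
#[local] Hint Resolve q_ge0 : core.

Lemma cprob_ge0 S m : 0 <= cprob S m.
Proof.
elim/ltn_ind: m => -[|m] IH; first by rewrite cprob0.
rewrite cprobS sumr_ge0 // => k _.
by rewrite mulr_ge0 ?reach_law_ge0 ?IH //; lia.
Qed.

Lemma cprob_le (S S' : pred nat) m :
  (forall k, S k -> S' k) -> cprob S m <= cprob S' m.
Proof.
move=> SS'; elim/ltn_ind: m => -[|m] IH; first by rewrite cprob0.
rewrite !cprobS big_mkcond [leRHS]big_mkcond /=; apply: ler_sum => k _.
case: ifP => [/SS' ->|_]; first by rewrite ler_wpM2l ?reach_law_ge0 ?IH //; lia.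
by case: ifP => // _; rewrite mulr_ge0 ?reach_law_ge0 ?cprob_ge0.
Qed.

Lemma cprob_le1 S m : cprob S m <= 1.
Proof. by rewrite -(cprobT m); apply: cprob_le. Qed.

(* Markov's inequality for the component of one vertex, applied vertex by vertex. *)
Lemma cprob_subcritical (r : R) (M m : nat) : 0 < r -> (m <= M)%N ->
  M%:R * (1 - q) < 1 -> (r * (1 - M%:R * (1 - q)))^-1 <= 1 ->
  (1 - (r * (1 - M%:R * (1 - q)))^-1) ^+ m <= cprob (fun k => k%:R <= r) m.
Proof.
move=> r0 + lM; set d := 1 - _ * _; set t := _^-1 => lmM lt1.
have d0 : 0 < d by rewrite subr_gt0.
have c0 : 0 <= 1 - t by rewrite subr_ge0.
have t0 : 0 <= t by rewrite invr_ge0 mulr_ge0 ?ltW.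
have p0 : 0 <= 1 - q by have := q1 1; rewrite expr1.
elim/ltn_ind: m lmM => -[|m] IH lmM; first by rewrite cprob0 expr0.
rewrite cprobS.
have lm : m%:R * (1 - q) <= M%:R * (1 - q) by rewrite ler_wpM2r // ler_nat ltnW.
(* The component of the fixed vertex has [k + 1] vertices and mean size at most
   [1 / (1 - m (1 - q))]. As [M] stays fixed while [m] decreases, one [t] serves every stage. *)
have tail : 1 - t <= \sum_(k < m.+1 | k.+1%:R <= r) reach_law q 1 m k.
  have := reach_law_sum q 1 m.
  rewrite (bigID (fun k : 'I_m.+1 => k.+1%:R <= r)) /= => e.
  suff : \sum_(k < m.+1 | ~~ (k.+1%:R <= r)) reach_law q 1 m k <= t by lra.
  rewrite /t invfM ler_pdivlMl // mulr_sumr.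
  have := @reach_law_mean R q q_ge0 q_le1 1 m (le_lt_trans lm lM).
  rewrite mul1r => h.
  apply: le_trans (_ : \sum_(k < m.+1) (reach_law q 1 m k * k%:R + reach_law q 1 m k) <= _).
    rewrite big_mkcond; apply: ler_sum => k _; case: ifP => [hk|_]; last first.
      have h0 := reach_law_ge0 q_ge0 q_le1 1 m k.
      by rewrite addr_ge0 // mulr_ge0.
    rewrite -[X in _ + X]mulr1 -mulrDr natr1 mulrC ler_wpM2l ?reach_law_ge0 //.
    by rewrite ltW // ltNge.
  rewrite big_split /= reach_law_sum.
  have d' : 0 < 1 - m%:R * (1 - q) by rewrite /d in d0; lra.
  apply: le_trans (lerD h (lexx 1)) _.
  rewrite -[X in _ + X](divff (lt0r_neq0 d')) -mulrDl subrKC mul1r.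
  by rewrite lef_pV2 ?posrE // /d; lra.
apply: le_trans (_ : \sum_(k < m.+1 | k.+1%:R <= r) reach_law q 1 m k * (1 - t) ^+ m <= _).
  by rewrite -mulr_suml exprS ler_wpM2r ?exprn_ge0.
apply: ler_sum => k _; rewrite ler_wpM2l ?reach_law_ge0 //.
apply: le_trans (IH (m - k)%N _ _); rewrite ?ltnS ?leq_subr //; last first.
  exact: leq_trans (leq_subr _ _) (ltnW lmM).
by rewrite ler_wiXn2l ?leq_subr // lerBlDr lerDl.
Qed.

(** Since [1 - q^m = q^(m-k) (1 - q^k) + (1 - q^(m-k))], the product of the bounds for a component
    of size [k] and for the rest is a single binomial term of [(1 - q^m)^m]. The constant [K] and
    the number of terms, at most [M], are paid by [T^k], which is affordable when [S] admits only
    large [k]. *)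
Lemma cprob_large_le (S : pred nat) (K T : R) (M m : nat) : 0 <= K -> 0 <= T ->
  (forall k, S k.+1 -> (k.+1 <= M)%N -> reach q 1 k <= K * (1 - q ^+ k.+1) ^+ k.+1) ->
  (forall k, S k.+1 -> (k.+1 <= M)%N -> K * M%:R <= T ^+ k.+1) ->
  (m <= M)%N -> cprob S m <= T ^+ m * (1 - q ^+ m) ^+ m.
Proof.
move=> K0 T0 hK hT; elim/ltn_ind: m => -[|m] IH lmM; first by rewrite cprob0 !expr0 mulr1.
have M0 : (0 : R) < M%:R by rewrite ltr0n; lia.
rewrite cprobS.
set B := T ^+ m.+1 * _.
have B0 : 0 <= B by rewrite mulr_ge0 ?exprn_ge0.
apply: le_trans (_ : \sum_(k < m.+1) B * M%:R^-1 <= _); last first.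
  rewrite sumr_const card_ord -[leLHS]mulr_natr -mulrA -[leRHS]mulr1 ler_wpM2l //.
  by rewrite ler_pdivrMl // mulr1 ler_nat.
rewrite big_mkcond; apply: ler_sum => k _; case: ifP => [Sk|_]; last first.
  by rewrite mulr_ge0 // invr_ge0 ltW.
have lkm : (k <= m)%N by rewrite -ltnS.
have lkM : (k.+1 <= M)%N by lia.
have IHk := IH (m - k)%N _ _.
apply: le_trans (_ : 'C(m.+1, k.+1)%:R * (K * (1 - q ^+ k.+1) ^+ k.+1) *
    q ^+ (k.+1 * (m - k)) * (T ^+ (m - k) * (1 - q ^+ (m - k)) ^+ (m - k)) <= _).
  rewrite /reach_law add1n ler_pM ?mulr_ge0 ?exprn_ge0 ?reach_ge0 ?cprob_ge0 //; last first.
    by apply: IHk; lia.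
  rewrite ler_wpM2r ?exprn_ge0 // ler_pM ?reach_ge0 //; last exact: hK.
  by rewrite ler_nat binS leq_addl.
have key : 'C(m.+1, k.+1)%:R * (q ^+ (m - k) * (1 - q ^+ k.+1)) ^+ k.+1 *
    (1 - q ^+ (m - k)) ^+ (m.+1 - k.+1) <= (1 - q ^+ m.+1) ^+ m.+1.
  have -> : 1 - q ^+ m.+1 = q ^+ (m - k) * (1 - q ^+ k.+1) + (1 - q ^+ (m - k)).
    have -> : q ^+ m.+1 = q ^+ (m - k) * q ^+ k.+1.
      by rewrite -exprD addnS subnK.
    by ring.
  by apply: binom_term_le; rewrite ?mulr_ge0 ?exprn_ge0.
rewrite subSS exprMn -exprM in key.
have KT : K <= T ^+ k.+1 / M%:R by rewrite ler_pdivlMr //; apply: hT.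
have -> : 'C(m.+1, k.+1)%:R * (K * (1 - q ^+ k.+1) ^+ k.+1) *
    q ^+ (k.+1 * (m - k)) * (T ^+ (m - k) * (1 - q ^+ (m - k)) ^+ (m - k)) =
  K * (T ^+ (m - k) * ('C(m.+1, k.+1)%:R * (q ^+ ((m - k) * k.+1) * (1 - q ^+ k.+1) ^+ k.+1) *
    (1 - q ^+ (m - k)) ^+ (m - k))) by rewrite [((m - k) * _)%N]mulnC; ring.
apply: le_trans (_ : K * (T ^+ (m - k) * (1 - q ^+ m.+1) ^+ m.+1) <= _).
  rewrite ler_wpM2l ?ler_wpM2l ?exprn_ge0 //.
apply: le_trans (ler_wpM2r _ KT) _; first by rewrite mulr_ge0 ?exprn_ge0.
rewrite /B [leRHS]mulrAC; have -> : T ^+ m.+1 = T ^+ k.+1 * T ^+ (m - k).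
  by rewrite -exprD addSn subnKC.
rewrite le_eqVlt; apply/orP; left; apply/eqP; ring.
Qed.

(** The term in which the component of the fixed vertex is the whole graph. *)
Lemma reach_le_cprob (S : pred nat) m : S m.+1 -> reach q 1 m <= cprob S m.+1.
Proof.
move=> Sm; rewrite cprobS (bigD1 ord_max) //= subnn cprob0 mulr1.
rewrite /reach_law binn mul1r subnn muln0 expr0 mulr1 lerDl sumr_ge0 // => k _.
by rewrite mulr_ge0 ?reach_law_ge0 ?cprob_ge0.
Qed.

(** * Rescaled probabilities as coefficients of exponentials *)

Variables (N : R).
Hypothesis N_gt0 : 0 < N.

(* Multiplication by [gam] turns the recursion of [cprob] into the recursion [hcprob_rec] of the
   coefficients of the exponential of a power series. *)
Definition gam (m : nat) : R := N ^+ m / (m`!%:R * q ^+ 'C(m, 2)).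

Lemma gam_gt0 m : 0 < gam m.
Proof. by rewrite divr_gt0 ?mulr_gt0 ?exprn_gt0 ?ltr0n ?fact_gt0. Qed.

Lemma gam0 : gam 0 = 1.
Proof. by rewrite /gam expr0 fact0 bin0n expr0 mulr1 divr1. Qed.

Lemma gamS m : gam m.+1 * (m.+1%:R * q ^+ m) = N * gam m.
Proof.
rewrite /gam exprS factS binS bin1 exprD natrM.
have h : m`!%:R != 0 :> R by rewrite pnatr_eq0 -lt0n fact_gt0.
have h1 : m.+1%:R != 0 :> R by rewrite pnatr_eq0.
have h2 k : q ^+ k != 0 by rewrite expf_neq0 // lt0r_neq0.
move: (h2 m) (h2 'C(m, 2)) h h1; move: (m`!%:R : R) (m.+1%:R : R) (q ^+ m) (q ^+ 'C(m, 2)).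
by move=> a b c d h3 h4 h5 h6; field; rewrite h3 h4 h5 h6.
Qed.

Lemma gam_bin a b : gam (a + b) * ('C(a + b, a)%:R * q ^+ (a * b)) = gam a * gam b.
Proof.
have lab : (a <= a + b)%N by rewrite leq_addr.
rewrite /gam bin2D -(bin_fact lab) addKn !natrM !exprD.
have h j : j`!%:R != 0 :> R by rewrite pnatr_eq0 -lt0n fact_gt0.
have h2 j : q ^+ j != 0 by rewrite expf_neq0 // lt0r_neq0.
have h3 : 'C(a + b, a)%:R != 0 :> R by rewrite pnatr_eq0 -lt0n bin_gt0.
move: (h a) (h b) h3 (h2 'C(a, 2)) (h2 'C(b, 2)) (h2 (a * b)%N).
move: (a`!%:R : R) (b`!%:R : R) ('C(a + b, a)%:R : R)
  (q ^+ 'C(a, 2)) (q ^+ 'C(b, 2)) (q ^+ (a * b)).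
move=> x y z u v w h4 h5 h6 h7 h8 h9.
by field; rewrite h4 h5 h6 h7 h8 h9.
Qed.

Lemma gam_mul m k : (k <= m)%N ->
  m.+1%:R * (gam m.+1 * ('C(m, k)%:R * q ^+ (k.+1 * (m - k)))) =
  k.+1%:R * gam k.+1 * gam (m - k).
Proof.
move=> lkm; rewrite -[RHS]mulrA -gam_bin.
have -> : (k.+1 + (m - k) = m.+1)%N by rewrite addSn subnKC.
have := mul_bin_diag m.+1 k => /= /(congr1 (fun j => j%:R : R)); rewrite !natrM => e.
transitivity (m.+1%:R * 'C(m, k)%:R * (gam m.+1 * q ^+ (k.+1 * (m - k)))); first by ring.
by rewrite e; ring.
Qed.

(** Weights of connected graphs: for [k > 0], the coefficients of the logarithm of the series with
    coefficients [gam m]. The value [cgam 0 = 1] is a default, killed by the factor [k] in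
    [hcprob_rec]. *)
Definition cgam (k : nat) : R := reach q 1 k.-1 * gam k.

Definition hcprob (S : pred nat) (m : nat) : R := cprob S m * gam m.

Lemma cgam_ge0 k : 0 <= cgam k.
Proof. by rewrite mulr_ge0 ?reach_ge0 // ltW ?gam_gt0. Qed.

Lemma hcprob_ge0 S m : 0 <= hcprob S m.
Proof. by rewrite mulr_ge0 ?cprob_ge0 // ltW ?gam_gt0. Qed.

Let term_ge0 S k m : 0 <= cgam k * hcprob S m.
Proof. exact: mulr_ge0 (cgam_ge0 _) (hcprob_ge0 _ _). Qed.

Let term_ge0' S k m : 0 <= k%:R * cgam k * hcprob S m.
Proof. by rewrite -mulrA mulr_ge0. Qed.

Lemma hcprob0 S : hcprob S 0 = 1.
Proof. by rewrite /hcprob cprob0 gam0 mulr1. Qed.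

Lemma hcprobT m : hcprob xpredT m = gam m.
Proof. by rewrite /hcprob cprobT mul1r. Qed.

Lemma hcprob_le_gam S m : hcprob S m <= gam m.
Proof. by rewrite -[leRHS]mul1r ler_wpM2r ?cprob_le1 // ltW ?gam_gt0. Qed.

(** Coefficient form of [x H' = (x C') H] for [H = exp C], where [C] has the coefficients [cgam k]
    for the positive [k] in [S]. *)
Lemma hcprob_rec S m :
  m%:R * hcprob S m = \sum_(k < m.+1 | S k) k%:R * cgam k * hcprob S (m - k).
Proof.
rewrite big_mkcond big_ord_recl /= !mul0r if_same add0r.
case: m => [|m]; first by rewrite mul0r big_ord0.
rewrite /hcprob cprobS mulr_suml mulr_sumr big_mkcond.
apply: eq_bigr => k _; rewrite /= /bump add1n; case: ifP => // _.
rewrite subSS /cgam /= mulrCA.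
have lkm : (k <= m)%N by rewrite -ltnS.
transitivity (reach q 1 k * cprob S (m - k) *
   (m.+1%:R * (gam m.+1 * ('C(m, k)%:R * q ^+ (k.+1 * (m - k)))))).
  by rewrite /reach_law add1n; ring.
by rewrite gam_mul //; ring.
Qed.

Lemma hcprob_ge_term (S : pred nat) m k : S k -> (k <= m)%N ->
  k%:R * cgam k * hcprob S (m - k) <= m%:R * hcprob S m.
Proof.
move=> Sk lkm; rewrite hcprob_rec (bigD1 (Ordinal (lkm : (k < m.+1)%N))) //=.
by rewrite lerDl sumr_ge0 // => i _; apply: term_ge0'.
Qed.

Lemma cgam1 : cgam 1 = N.
Proof. by rewrite /cgam reach0r mul1r /gam expr1 bin_small // expr0 mulr1 divr1. Qed.

(** In terms of series [H = H' exp D], with [D] collecting the sizes in [S] but not in [S'], and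
    [exp D <= 1 + D exp D] coefficientwise. It is a union bound over one component with size in
    [D]. *)
Lemma hcprob_split_le (S S' : pred nat) m : (forall k, S' k -> S k) ->
  hcprob S m <= hcprob S' m +
    \sum_(k < m.+1 | S k && ~~ S' k) cgam k * hcprob S (m - k).
Proof.
move=> SS'; elim/ltn_ind: m => m IH.
case: m IH => [|m] IH.
  rewrite !hcprob0 lerDl sumr_ge0 // => k _.
  by rewrite mulr1 cgam_ge0.
have m0 : (0 : R) < m.+1%:R by rewrite ltr0n.
rewrite -(ler_pM2l m0) mulrDr !hcprob_rec.
rewrite (bigID (fun k : 'I_m.+2 => S' k)) /=.
rewrite (eq_bigl (fun k : 'I_m.+2 => S' k)); last first.
  by move=> k; case: (boolP (S' k)) => [/SS' ->|] //; rewrite andbF.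
pose G k l := k%:R * cgam k * (cgam l * hcprob S (m.+1 - k - l)).
have step : \sum_(k < m.+2 | S' k) k%:R * cgam k * hcprob S (m.+1 - k) <=
  \sum_(k < m.+2 | S' k) k%:R * cgam k * hcprob S' (m.+1 - k) +
  \sum_(l < m.+2 | S l && ~~ S' l) cgam l * ((m.+1 - l)%:R * hcprob S (m.+1 - l)).
  apply: le_trans (_ : \sum_(k < m.+2 | S' k) (k%:R * cgam k * hcprob S' (m.+1 - k) +
     \sum_(l < m.+2 | S l && ~~ S' l && (k + l < m.+2)%N) G k l) <= _).
    apply: ler_sum => k Sk.
    have [k0|k0] := posnP k.
      rewrite {1 2 3 4}k0 !mul0r add0r sumr_ge0 // => l _.
      by rewrite /G mulr_ge0 // mulr_ge0 ?cgam_ge0.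
    apply: le_trans (ler_wpM2l _ (IH (m.+1 - k)%N _)) _; last first.
      rewrite mulrDr lerD2l mulr_sumr.
      rewrite (big_ord_widen_cond m.+2 (fun l => S l && ~~ S' l)
        (fun l => k%:R * cgam k * (cgam l * hcprob S (m.+1 - k - l)))); last lia.
      rewrite le_eqVlt; apply/orP; left; apply/eqP; apply: eq_bigl => l.
      by congr (_ && _); have := ltn_ord k; lia.
    by lia.
    by rewrite mulr_ge0 ?cgam_ge0.
  rewrite big_split /= lerD2l.
  rewrite (exchange_big_dep (fun l : 'I_m.+2 => S l && ~~ S' l)) /= => [|k l _]; last first.
    by case/andP.
  apply: ler_sum => l /andP[Sl nSl]; rewrite hcprob_rec mulr_sumr.
  have ll : (l <= m.+1)%N by rewrite -ltnS.
  rewrite (big_ord_widen_cond m.+2 (fun k => S k)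
    (fun k => cgam l * (k%:R * cgam k * hcprob S (m.+1 - l - k)))); last lia.
  rewrite big_mkcond [leRHS]big_mkcond; apply: ler_sum => k _.
  rewrite Sl nSl /=; case: (boolP (S' k)) => [/SS' -> /=|_] /=; last first.
    by case: ifP => // _; rewrite mulr_ge0 ?cgam_ge0.
  have -> : (k + l < m.+2)%N = (k < (m.+1 - l).+1)%N by lia.
  case: ifP => // _; rewrite /G subnAC.
  by rewrite le_eqVlt; apply/orP; left; apply/eqP; ring.
apply: le_trans (lerD step (lexx _)) _.
(* The weights [m + 1 - l] from [step] and [l] from the sizes outside [S'] add up to the factor
   [m + 1] on the left. *)
rewrite -addrA lerD2l -big_split /= mulr_sumr; apply: ler_sum => k _.
have lk : (k <= m.+1)%N by rewrite -ltnS.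
rewrite le_eqVlt; apply/orP; left; apply/eqP.
by rewrite natrB //; ring.
Qed.

(** Bernoulli's inequality in the form [(1 - 1/(j+1))^j >= 1/(j+1)]. The factor [j + 1] stands in
    for [e], over an arbitrary ordered field. *)
Lemma natr_exp_ratio (j : nat) : j.+1%:R ^+ j <= j.+1%:R * j%:R ^+ j :> R.
Proof.
have bern k : 1 - k%:R / j.+1%:R <= (j%:R / j.+1%:R) ^+ k :> R.
  have -> : j%:R / j.+1%:R = 1 - j.+1%:R^-1 :> R.
    have h1 : j.+1%:R != 0 :> R by rewrite pnatr_eq0.
    by apply: (mulIf h1); rewrite mulrBl mulVf // mulfVK // mul1r -natr1 addrK.
  have h0 : 0 <= j.+1%:R^-1 :> R by rewrite invr_ge0.
  have h1 : j.+1%:R^-1 <= 1 :> R by rewrite invf_le1 ?ltr0n // ler1n.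
  elim: k => [|k IH]; first by rewrite mul0r subr0 expr0.
  rewrite exprS; apply: le_trans (ler_wpM2l _ IH); last by rewrite subr_ge0.
  have : 0 <= j.+1%:R^-1 * (k%:R / j.+1%:R) :> R by rewrite !mulr_ge0.
  rewrite -[k.+1%:R]natr1 mulrDl mul1r => h2.
  have -> : (1 - j.+1%:R^-1) * (1 - k%:R / j.+1%:R) =
    1 - (k%:R / j.+1%:R + j.+1%:R^-1) + j.+1%:R^-1 * (k%:R / j.+1%:R) :> R by ring.
  by rewrite lerDl.
have := bern j; rewrite expr_div_n ler_pdivlMr ?exprn_gt0 ?ltr0n // => h.
have p0 : (0 : R) < j.+1%:R by rewrite ltr0n.
have -> : j.+1%:R ^+ j = j.+1%:R * ((1 - j%:R / j.+1%:R) * j.+1%:R ^+ j) :> R.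
  rewrite mulrA mulrBr mulr1 mulrCA divff ?lt0r_neq0 // mulr1 -natr1.
  by rewrite [_ - _]addrAC subrr add0r mul1r.
by rewrite ler_wpM2l.
Qed.

(** [reach_le] above and [reach_ge] below reduce the comparison to powers of [1 - q^(j+2)] and
    [1 - q^(j+1)], whose ratio concavity bounds by [(j+2)/(j+1)]. *)
Lemma reachS_le j : reach q 1 j.+1 <= (j.+2 * j.+1)%:R * reach q 1 j.
Proof.
apply: le_trans (reach_le q_ge0 q_le1 1 j.+1) _; rewrite add1n exprSr.
apply: le_trans (_ : (1 - q ^+ j.+2) ^+ j <= _).
  by rewrite -[leRHS]mulr1 ler_wpM2l ?exprn_ge0 // lerBlDr lerDl exprn_ge0.
have p0 : (0 : R) < j.+1%:R ^+ j.+1 by rewrite exprn_gt0 // ltr0n.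
have := one_sub_exp_ratio q_ge0 q_le1 j.+1 1; rewrite addn1 => h.
have g := reach_ge q_ge0 q_le1 1 j; rewrite mul1r add1n in g.
have h' : j.+1%:R ^+ j * (1 - q ^+ j.+2) ^+ j <= j.+2%:R ^+ j * (1 - q ^+ j.+1) ^+ j.
  by rewrite -!exprMn lerXn2r ?nnegrE ?mulr_ge0.
rewrite -(ler_pM2l p0) exprS -mulrA.
apply: le_trans (ler_wpM2l _ h') _ => //.
have k := natr_exp_ratio j.+1.
have k' : j.+2%:R ^+ j <= j.+1%:R ^+ j.+1 :> R.
  have p2 : (0 : R) < j.+2%:R by rewrite ltr0n.
  by rewrite -(ler_pM2l p2) -exprS.
apply: le_trans (ler_wpM2l _ (ler_pM _ _ k' g)) _; rewrite ?exprn_ge0 //.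
rewrite natrM !exprS.
have -> : j.+1%:R * (j.+1%:R * j.+1%:R ^+ j * (j.+1%:R * reach q 1 j)) =
  (j.+1%:R * j.+1%:R ^+ j) * (j.+1%:R * j.+1%:R * reach q 1 j) by ring.
rewrite ler_wpM2l ?mulr_ge0 ?exprn_ge0 // ler_wpM2r ?reach_ge0 // ler_wpM2r //.
by rewrite ler_nat.
Qed.

Lemma cgamS_le j : (0 < j)%N ->
  j.+1%:R * cgam j.+1 <= (j.+1%:R * N / q ^+ j) * (j%:R * cgam j).
Proof.
case: j => // j _; rewrite /cgam /=.
have e := gamS j.+1.
have g : gam j.+2 = N * gam j.+1 / (j.+2%:R * q ^+ j.+1).
  by rewrite -e mulfK // mulf_neq0 ?pnatr_eq0 // expf_neq0 // lt0r_neq0.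
rewrite g.
have h2 : q ^+ j.+1 != 0 by rewrite expf_neq0 // lt0r_neq0.
have h1 : j.+2%:R != 0 :> R by rewrite pnatr_eq0.
have h0 : 0 <= N * gam j.+1 / q ^+ j.+1.
  by apply: divr_ge0; [apply: mulr_ge0; apply: ltW => //; apply: gam_gt0 | apply: exprn_ge0].
have -> : j.+2%:R * (reach q 1 j.+1 * (N * gam j.+1 / (j.+2%:R * q ^+ j.+1))) =
  reach q 1 j.+1 * (N * gam j.+1 / q ^+ j.+1).
  move: h1 h2; move: (j.+2%:R : R) (q ^+ j.+1) => a b h1 h2.
  by field; rewrite h1 h2.
have -> : j.+2%:R * N / q ^+ j.+1 * (j.+1%:R * (reach q 1 j * gam j.+1)) =
  (j.+2 * j.+1)%:R * reach q 1 j * (N * gam j.+1 / q ^+ j.+1) by rewrite natrM; ring.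
by rewrite ler_wpM2r // reachS_le.
Qed.

(** Regularity in the number of vertices, which later absorbs rounding. The term [k + 1] for [m + 1]
    vertices is compared with the term [k] for [m] vertices, so [S] must be closed downwards; the
    term of size one is left over and bounded directly. *)
Lemma hcprobS_le (S : pred nat) m : (forall k, S k.+1 -> S k) ->
  hcprob S m.+1 <= (m.+1%:R * N / q ^+ m) * hcprob S m.
Proof.
move=> Sdown.
have K1 : N <= m.+1%:R * N / q ^+ m.
  rewrite ler_pdivlMr ?exprn_gt0 // mulrC ler_wpM2r ?(ltW N_gt0) //.
  by apply: le_trans (_ : 1 <= _); rewrite ?exprn_ile1 ?ler1n.
have K0 : 0 <= m.+1%:R * N / q ^+ m by apply: le_trans K1; rewrite ltW.
have m0 : (0 : R) < m.+1%:R by rewrite ltr0n.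
rewrite -(ler_pM2l m0) hcprob_rec big_mkcond big_ord_recl /= !mul0r if_same add0r.
rewrite big_ord_recl /= /bump !add1n subSS subn0 mul1r cgam1.
apply: le_trans (_ : m.+1%:R * N / q ^+ m * hcprob S m +
   m.+1%:R * N / q ^+ m * (m%:R * hcprob S m) <= _); last first.
  by rewrite -mulrDr -[X in X + _]mul1r -mulrDl nat1r mulrCA.
rewrite lerD //.
  by case: ifP => _; [rewrite ler_wpM2r ?hcprob_ge0 | rewrite mulr_ge0 ?hcprob_ge0].
rewrite hcprob_rec [X in _ <= _ * X]big_mkcond [X in _ <= _ * X]big_ord_recl /=.
rewrite !mul0r if_same add0r mulr_sumr; apply: ler_sum => k _.
rewrite /bump !add1n !subSS.
case: ifP => [/Sdown ->|_]; last first.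
  by rewrite mulr_ge0 //; case: ifP => // _; apply: term_ge0'.
rewrite [leRHS]mulrA ler_wpM2r ?hcprob_ge0 //.
apply: le_trans (cgamS_le (isT : (0 < k.+1)%N)) _.
have lk : (k.+1 <= m)%N by case: k.
apply: ler_wpM2r; first exact: mulr_ge0 (ler0n _ _) (cgam_ge0 _).
rewrite ler_pM ?invr_ge0 ?exprn_ge0 ?mulr_ge0 ?(ltW N_gt0) //.
  by rewrite ler_wpM2r ?(ltW N_gt0) // ler_nat.
by rewrite lef_pV2 ?posrE ?exprn_gt0 // ler_wiXn2l.
Qed.

(* [lam ^+ m] is a supersolution of the recursion above the critical size [M]:
   the comparison uses that the component sizes at size [M] have total mass one. *)
Lemma hcprob_supersolution (S : pred nat) (lam F : R) (M r m : nat) :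
  0 < lam -> 0 <= F -> (r < M)%N -> (forall k, S k -> (k <= r)%N) ->
  (forall i, (M - r <= i)%N -> (i < M)%N -> N <= lam * (i.+1%:R * q ^+ i)) ->
  (forall i, (M - r <= i)%N -> (i < M)%N -> gam i <= F * lam ^+ i) ->
  (M - r <= m)%N -> hcprob S m <= F * lam ^+ m.
Proof.
move=> l0 F0 rM Sr hN hF.
(* By [gamS] the ratio [gam (i+1) / gam i] is [N / ((i+1) q^i)], at most [lam] on the window of [r]
   sizes below [M]. *)
have gamM k : (k <= r)%N -> gam M <= lam ^+ k * gam (M - k).
  elim: k => [|k IH] lkr; first by rewrite subn0 expr0 mul1r.
  apply: le_trans (IH (ltnW lkr)) _; rewrite exprSr -mulrA ler_wpM2l ?exprn_ge0 ?(ltW l0) //.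
  set i := (M - k.+1)%N.
  have lkM : (k < M)%N by apply: leq_trans rM; rewrite ltnS ltnW.
  have -> : (M - k = i.+1)%N by rewrite /i subnSK.
  have iM : (i < M)%N by rewrite /i ltn_subrL /= (leq_trans _ rM).
  have Mi : (M - r <= i)%N by rewrite /i leq_sub2l.
  have w0 : 0 < i.+1%:R * q ^+ i by rewrite mulr_gt0 ?ltr0n ?exprn_gt0.
  rewrite -(ler_pM2r w0) gamS mulrAC ler_wpM2r ?hN //.
  by rewrite ltW ?gam_gt0.
have M0 : (0 : R) < M%:R by rewrite ltr0n (leq_trans _ rM).
have lk0 k : 0 < lam ^+ k by rewrite exprn_gt0.
(* With all sizes allowed the recursion at [M] reads [M gam M = sum k cgam k gam (M-k)]; [gamM]
   turns it into this bound, which supports the induction for every [m >= M]. *)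
have mass : \sum_(k < M.+1 | S k) k%:R * cgam k / lam ^+ k <= M%:R.
  have gM : 0 < gam M by apply: gam_gt0.
  rewrite -(ler_pM2r gM) -[in leRHS]hcprobT hcprob_rec mulr_suml.
  rewrite big_mkcond [leRHS]big_mkcond /=; apply: ler_sum => k _.
  case: ifP => [/Sr kr|_]; last by rewrite -mulrA mulr_ge0 // mulr_ge0 ?cgam_ge0 ?hcprob_ge0.
  rewrite hcprobT -[leLHS]mulrA.
  apply: ler_wpM2l; first exact: mulr_ge0 (ler0n _ _) (cgam_ge0 _).
  by rewrite mulrC ler_pdivrMr // mulrC gamM.
elim/ltn_ind: m => m IH lm.
have [mM|Mm] := ltnP m M; first by apply: le_trans (hcprob_le_gam S m) _; apply: hF.
have m0 : (0 : R) < m%:R by rewrite (lt_le_trans M0) ?ler_nat.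
rewrite -(ler_pM2l m0) hcprob_rec.
apply: le_trans (_ : \sum_(k < m.+1 | S k) (k%:R * cgam k / lam ^+ k) * (F * lam ^+ m) <= _).
  apply: ler_sum => k /Sr kr.
  have [k0|k0] := posnP k; first by rewrite k0 !mul0r.
  have km : (k <= m)%N by rewrite -ltnS.
  rewrite -mulrA -[leRHS]mulrA -[leRHS]mulrA ler_wpM2l //.
  rewrite ler_wpM2l ?cgam_ge0 //.
  apply: le_trans (IH (m - k)%N _ _) _; first by rewrite ltn_subrL k0 (leq_trans k0).
    by rewrite leq_sub.
  by rewrite mulrCA ler_wpM2l // ler_pdivlMl // -exprD subnKC.
rewrite -mulr_suml ler_wpM2r ?mulr_ge0 ?(ltW (lk0 _)) //.
apply: le_trans (_ : M%:R <= _); last by rewrite ler_nat.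
apply: le_trans mass; rewrite le_eqVlt; apply/orP; left; apply/eqP.
rewrite [RHS](big_ord_widen_cond m.+1 (fun k => S k) (fun k => k%:R * cgam k / lam ^+ k)) //.
apply: eq_bigl => k; case: (boolP (S k)) => //= /Sr kr.
by rewrite ltnS (leq_trans kr) // ltnW.
Qed.

End ComponentSizes.

(** * From graphs to recursions *)

Section Graph.
Variables (n : nat).
Implicit Types (U K L W : {set 'I_n}) (E : {set 'I_n * 'I_n}) (v w : 'I_n).

Definition pairs_in U : {set 'I_n * 'I_n} :=
  [set x in pairs n | (x.1 \in U) && (x.2 \in U)].

Lemma adj_sym E : symmetric (adj E).
Proof. by move=> i j; rewrite /adj orbC. Qed.

Lemma comp_self E v : v \in comp E v.
Proof. by rewrite inE connect0. Qed.

Lemma comp_eq E v w : w \in comp E v -> comp E w = comp E v.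
Proof.
rewrite inE => vw; apply/setP => u; rewrite !inE.
by rewrite (same_connect (sym_connect_sym (@adj_sym E)) vw).
Qed.

Lemma adj_pairs_in E U i j : E \subset pairs_in U -> adj E i j -> (i \in U) && (j \in U).
Proof.
move=> /subsetP EU; rewrite /adj => /orP[] /EU; rewrite !inE => /andP[_] //=.
by rewrite andbC.
Qed.

Lemma comp_closed E v (P : pred 'I_n) : P v ->
  (forall i j, P i -> adj E i j -> P j) -> forall w, w \in comp E v -> P w.
Proof.
move=> Pv h w; rewrite inE => /connectP[p + ->].
elim: p v Pv => //= x p IH v Pv /andP[vx px].
by apply: (IH x) => //; apply: h vx.
Qed.

Lemma comp_sub E U v : E \subset pairs_in U -> v \in U -> comp E v \subset U.
Proof.
move=> EU vU; apply/subsetP; apply: (@comp_closed E v (mem U)) => // i j _.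
by move/(adj_pairs_in EU)/andP=> [].
Qed.

Lemma comp_union E1 E2 K L v : E1 \subset pairs_in K -> E2 \subset pairs_in L ->
  [disjoint K & L] -> v \in K -> comp (E1 :|: E2) v = comp E1 v.
Proof.
move=> E1K E2L KL vK; apply/setP => w; apply/idP/idP; last first.
  rewrite !inE; apply: connect_sub => i j; rewrite /adj => h; apply: connect1.
  by rewrite /adj !inE; case/orP: h => ->; rewrite ?orbT.
have : forall w, w \in comp (E1 :|: E2) v -> (w \in K) && (w \in comp E1 v).
  apply: comp_closed => [|i j /andP[iK vi]]; first by rewrite vK comp_self.
  have [a1 _|a1] := boolP (adj E1 i j).
    have /andP[_ ->] /= := adj_pairs_in E1K a1.
    by move: vi; rewrite !inE => vi; apply: connect_trans vi (connect1 a1).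
  have [/(adj_pairs_in E2L)/andP[iL _]|a2] := boolP (adj E2 i j).
    by have := disjointFr KL iK; rewrite iL.
  move: a1 a2; rewrite /adj !inE !negb_or => /andP[/negPf -> /negPf ->].
  by move=> /andP[/negPf -> /negPf ->].
by move=> h /h /andP[].
Qed.

Lemma edge_pairs_in E U (P : pred 'I_n) : E \subset pairs_in U ->
  (forall i j, adj E i j -> P i = P j) ->
  E \subset pairs_in [set i in U | P i] :|: pairs_in [set i in U | ~~ P i].
Proof.
move=> EU h; apply/subsetP => -[i j] ij.
have a : adj E i j by rewrite /adj ij.
have := subsetP EU _ ij; rewrite !inE /= => /and3P[-> -> ->] /=.
by rewrite -(h _ _ a); case: (P i).
Qed.

Lemma pairs_in_sub U K : K \subset U -> pairs_in K \subset pairs_in U.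
Proof.
move=> /subsetP KU; apply/subsetP => x; rewrite !inE.
by case/and3P=> -> /KU -> /KU ->.
Qed.

Lemma pairs_in_disjoint K L : [disjoint K & L] -> [disjoint pairs_in K & pairs_in L].
Proof.
move=> KL; rewrite disjoint_subset; apply/subsetP => x; rewrite !inE.
by case/and3P=> -> xK _; rewrite (disjointFr KL xK).
Qed.

Lemma card_pairs_inU K L : [disjoint K & L] ->
  (#|pairs_in (K :|: L)| = #|pairs_in K| + #|pairs_in L| + #|K| * #|L|)%N.
Proof.
move=> KL.
(* Cross pairs are stored in increasing order, so they lie in [K x L] or in [L x K]; swapping those
   of the second kind fills up [K x L]. *)
pose X := [set x in setX K L | (val x.1 < val x.2)%N].
pose Y := [set x in setX L K | (val x.1 < val x.2)%N].
pose Y' := [set x in setX K L | (val x.2 < val x.1)%N].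
have cY : #|Y| = #|Y'|.
  have <- : [set (x.2, x.1) | x in Y] = Y'.
    apply/setP => -[i j]; apply/imsetP/idP => [[[a b]]|].
      by rewrite !inE /= => /andP[/andP[aL bK] ab] [-> ->]; rewrite aL bK.
    rewrite !inE /= => /andP[/andP[aL bK] ab].
    by exists (j, i); rewrite // !inE /= aL bK.
  by rewrite card_imset // => -[a b] [c d] [-> ->].
have cXY : (#|X| + #|Y'| = #|K| * #|L|)%N.
  rewrite -cardsX -cardsUI.
  have -> : X :&: Y' = set0.
    by apply/setP => x; rewrite !inE; case: ltngtP => _; rewrite ?andbF.
  rewrite cards0 addn0; congr (#|pred_of_set _|); apply/setP => -[i j]; rewrite !inE /=.
  case: (boolP (i \in K)) => //= iK; case: (boolP (j \in L)) => //= jL.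
  case: ltngtP => // e; have ij : i = j by apply: val_inj.
  by have := disjointFr KL iK; rewrite ij jL.
rewrite -cXY -cY -cardsUI.
have -> : pairs_in K :&: pairs_in L = set0.
  by apply/eqP; rewrite setI_eq0 pairs_in_disjoint.
rewrite cards0 addn0.
have XY0 : X :&: Y = set0.
  apply/setP => -[i j]; rewrite !inE /=.
  by case: (boolP (i \in K)) => iK; rewrite ?andbF //= (disjointFr KL iK) andbF.
have e1 : (#|X| + #|Y| = #|X :|: Y|)%N by rewrite -cardsUI XY0 cards0 addn0.
rewrite e1 -cardsUI.
have -> : (pairs_in K :|: pairs_in L) :&: (X :|: Y) = set0.
  apply/setP => -[i j]; rewrite !inE /=.
  case: (boolP (i \in K)) => iK; case: (boolP (j \in K)) => jK;
    rewrite ?(disjointFr KL iK) ?(disjointFr KL jK) ?andbF ?andbT ?orbF //=.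
rewrite cards0 addn0; congr (#|pred_of_set _|); apply/setP => -[i j]; rewrite !inE /=.
case: (i < j)%N; rewrite ?andbF ?andbT //=.
by case: (i \in K); case: (j \in K); case: (i \in L); case: (j \in L).
Qed.

Variables (R : realType) (p : R).
Let q := 1 - p.

Definition edge_weight (P E : {set 'I_n * 'I_n}) : R := p ^+ #|E| * q ^+ (#|P| - #|E|).

Lemma sum_edge_weight (P : {set 'I_n * 'I_n}) :
  \sum_(E : {set 'I_n * 'I_n} | E \subset P) edge_weight P E = 1.
Proof.
rewrite (partition_big (fun E : {set 'I_n * 'I_n} => inord #|E| : 'I_#|P|.+1) xpredT) //=.
transitivity ((p + q) ^+ #|P|); last by rewrite /q addrC subrK expr1n.
rewrite -binom_sum; apply: eq_bigr => j _.
rewrite (eq_bigl (fun E => E \in [set A : {set 'I_n * 'I_n} | A \subset P & #|A| == j])); last first.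
  move=> E; rewrite inE; case: (boolP (E \subset P)) => //= /subset_leq_card EP.
  by rewrite -val_eqE /= inordK // ltnS.
rewrite (eq_bigr (fun=> p ^+ j * q ^+ (#|P| - j))) => [|E]; last first.
  by rewrite inE /edge_weight => /andP[_ /eqP ->].
by rewrite sumr_const cards_draws -mulr_natl; ring.
Qed.

(** Independence of the pairs inside [K], inside [L] and across; the power of [q] is the probability
    that no cross pair is an edge. *)
Lemma sum_edge_weight_union K L (F f g : {set 'I_n * 'I_n} -> R) : [disjoint K & L] ->
  (forall E1 E2, E1 \subset pairs_in K -> E2 \subset pairs_in L -> F (E1 :|: E2) = f E1 * g E2) ->
  \sum_(E : {set 'I_n * 'I_n} | E \subset pairs_in K :|: pairs_in L)
    edge_weight (pairs_in (K :|: L)) E * F E =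
  q ^+ (#|K| * #|L|) *
    (\sum_(E : {set 'I_n * 'I_n} | E \subset pairs_in K) edge_weight (pairs_in K) E * f E)
    * (\sum_(E : {set 'I_n * 'I_n} | E \subset pairs_in L) edge_weight (pairs_in L) E * g E).
Proof.
move=> KL FE; rewrite -mulrA big_distrlr /= mulr_sumr.
under [RHS]eq_bigr => E1 _ do rewrite mulr_sumr.
rewrite pair_big /=.
have PD := pairs_in_disjoint KL.
have split1 E1 E2 : E1 \subset pairs_in K -> E2 \subset pairs_in L -> (E1 :|: E2) :&: pairs_in K = E1.
  move=> h1 h2; rewrite setIUl (setIidPl h1).
  rewrite (_ : E2 :&: pairs_in K = set0) ?setU0 //.
  apply/eqP; rewrite setI_eq0 disjoint_sym; apply: disjointWr PD => //.
have split2 E1 E2 : E1 \subset pairs_in K -> E2 \subset pairs_in L -> (E1 :|: E2) :&: pairs_in L = E2.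
  move=> h1 h2; rewrite setIUl (setIidPl h2).
  rewrite (_ : E1 :&: pairs_in L = set0) ?set0U //.
  by apply/eqP; rewrite setI_eq0; apply: disjointWl PD.
rewrite (reindex_onto (fun x : {set 'I_n * 'I_n} * {set 'I_n * 'I_n} => x.1 :|: x.2)
  (fun E => (E :&: pairs_in K, E :&: pairs_in L))) /=; last first.
  by move=> E EKL; rewrite -setIUr; apply/setIidPl.
apply: eq_big => [[E1 E2]|[E1 E2] /= /andP[E12 /eqP[e1 e2]]] /=.
  apply/idP/idP => [/andP[_ /eqP[e1 e2]]|/andP[h1 h2]].
    by apply/andP; split; [rewrite -e1 subsetIr | rewrite -e2 subsetIr].
  by rewrite split1 // split2 // eqxx andbT setUSS.
have h1 : E1 \subset pairs_in K by rewrite -e1 subsetIr.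
have h2 : E2 \subset pairs_in L by rewrite -e2 subsetIr.
rewrite FE // /edge_weight card_pairs_inU //.
have -> : #|E1 :|: E2| = (#|E1| + #|E2|)%N.
  rewrite -cardsUI (_ : E1 :&: E2 = set0) ?cards0 ?addn0 //.
  by apply/eqP; rewrite setI_eq0; apply: disjointWl h1 (disjointWr h2 PD).
have l1 := subset_leq_card h1; have l2 := subset_leq_card h2.
have -> : (#|pairs_in K| + #|pairs_in L| + #|K| * #|L| - (#|E1| + #|E2|) =
  #|K| * #|L| + (#|pairs_in K| - #|E1|) + (#|pairs_in L| - #|E2|))%N.
  move: l1 l2; move: #|pairs_in K| #|pairs_in L| #|E1| #|E2| (#|K| * #|L|)%N => a b c d e; lia.
by rewrite !exprD; ring.
Qed.

Definition comps_in (S : pred nat) U E : bool := [forall v in U, S #|comp E v|].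

Definition comps_in_prob (S : pred nat) U : R :=
  \sum_(E : {set 'I_n * 'I_n} | E \subset pairs_in U) edge_weight (pairs_in U) E * (comps_in S U E)%:R.

Definition connected_prob K : R := \sum_(E : {set 'I_n * 'I_n} | E \subset pairs_in K)
   edge_weight (pairs_in K) E * ([forall v in K, comp E v == K])%:R.

Lemma comps_in_prob_rec S U v : v \in U ->
  comps_in_prob S U = \sum_(K : {set 'I_n} | (K \subset U) && (v \in K))
    if S #|K| then connected_prob K * q ^+ (#|K| * #|U :\: K|) * comps_in_prob S (U :\: K) else 0.
Proof.
move=> vU; rewrite /comps_in_prob.
rewrite (partition_big (fun E => comp E v) (fun K => (K \subset U) && (v \in K))) /=; last first.
  by move=> E EU; rewrite comp_sub // comp_self.
apply: eq_bigr => K /andP[KU vK]; set L := U :\: K.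
have KL : [disjoint K & L] by rewrite -setI_eq0 /L setIDA setIC -setIDA setDv setI0.
have UKL : U = K :|: L.
  by apply/setP => x; rewrite !inE; have := subsetP KU x; case: (x \in K) => //= ->.
(* When [K] is the component of [v], no edge leaves [K], so restricting to edges inside [K] or
   inside [L] loses nothing. *)
transitivity (\sum_(E : {set 'I_n * 'I_n} | E \subset pairs_in K :|: pairs_in L)
    edge_weight (pairs_in (K :|: L)) E *
    ((comp E v == K) && comps_in S U E)%:R).
  rewrite big_mkcond [RHS]big_mkcond /=; apply: eq_bigr => E _; rewrite -UKL.
  case: (boolP (E \subset pairs_in U)) => EU /=; last first.
    case: ifP => // h; case/negP: EU; apply: subset_trans h _.
    by rewrite subUset !pairs_in_sub // /L subsetDl.
  case: (comp E v =P K) => eK /=; last by rewrite mulr0 if_same.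
  suff -> : E \subset pairs_in K :|: pairs_in L by [].
  have := @edge_pairs_in E U (mem K) EU; have -> : [set i in U | mem K i] = K.
    by apply/setP => x; rewrite !inE; have := subsetP KU x;
       case: (x \in K) => //= [->|] //; rewrite andbF.
  have -> : [set i in U | ~~ mem K i] = L by apply/setP => x; rewrite !inE andbC.
  apply=> i j ij /=; rewrite -eK !inE.
  exact: (same_connect_r (sym_connect_sym (@adj_sym E)) (connect1 ij)).
rewrite (@sum_edge_weight_union K L _ (fun E => ([forall w in K, comp E w == K] && S #|K|)%:R)
  (fun E => (comps_in S L E)%:R)) //; last first.
  move=> E1 E2 h1 h2; rewrite -natrM mulnb; congr (_%:R); congr nat_of_bool.
  rewrite (comp_union h1 h2 KL vK).
  have -> : (comp E1 v == K) = [forall w in K, comp E1 w == K].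
    apply/eqP/forall_inP => [e w wK|h]; last by apply/eqP; apply: h.
    by rewrite (@comp_eq _ v) ?e.
  case: (boolP [forall w in K, _]) => //= /forall_inP hK.
  rewrite /comps_in UKL; apply/forall_inP/andP => [h|[SK /forall_inP hL] w].
    split.
      have := h v; rewrite inE vK (comp_union h1 h2 KL vK) (eqP (hK v vK)).
      by apply.
    apply/forall_inP => w wL; have := h w; rewrite inE wL orbT => /(_ isT).
    by rewrite setUC (comp_union h2 h1) // disjoint_sym.
  rewrite inE => /orP[wK|wL]; first by rewrite (comp_union h1 h2) // (eqP (hK w wK)).
  by rewrite setUC (comp_union h2 h1) ?hL // disjoint_sym.
case: ifP => SK; last first.
  rewrite [X in _ * X * _]big1 ?mulr0 ?mul0r // => E _.
  by rewrite andbF mulr0.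
rewrite [connected_prob K * _]mulrC; congr (_ * _ * _).
by apply: eq_bigr => E _; rewrite andbT.
Qed.

Lemma sum_card_subset U v (h : nat -> R) : v \in U ->
  \sum_(K : {set 'I_n} | (K \subset U) && (v \in K)) h #|K| =
  \sum_(j < #|U|) 'C(#|U|.-1, j)%:R * h j.+1.
Proof.
move=> vU; have cU : #|U| = #|U :\ v|.+1 by rewrite (cardsD1 v U) vU.
rewrite cU /=.
rewrite (reindex_onto (fun A => v |: A) (fun K => K :\ v)) /=; last first.
  by move=> K /andP[_ vK]; rewrite setD1K.
rewrite (eq_bigl (fun A : {set 'I_n} => A \subset U :\ v)); last first.
  move=> A; apply/idP/idP => [/andP[/andP[h1 _] /eqP <-]|h1].
    by apply: setSD.
  have vA : v \notin A by apply/negP => /(subsetP h1); rewrite !inE eqxx.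
  rewrite setU1K // eqxx andbT setU11 andbT subUset sub1set vU /=.
  by apply: subset_trans h1 (subsetDl _ _).
rewrite (partition_big (fun A : {set 'I_n} => inord #|A| : 'I_#|U :\ v|.+1) xpredT) //=.
apply: eq_bigr => j _.
rewrite (eq_bigl (fun A => A \in [set A : {set 'I_n} | A \subset U :\ v & #|A| == j])); last first.
  move=> E; rewrite inE; case: (boolP (E \subset U :\ v)) => //= /subset_leq_card EP.
  by rewrite -val_eqE /= inordK // ltnS.
rewrite (eq_bigr (fun=> h j.+1)) => [|A]; last first.
  rewrite inE => /andP[/subsetP h1 /eqP <-]; rewrite cardsU1.
  by have -> : v \notin A by apply/negP => /h1; rewrite !inE eqxx.
by rewrite sumr_const cards_draws mulr_natl.
Qed.

Lemma comps_in_probT U : comps_in_prob xpredT U = 1.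
Proof.
rewrite /comps_in_prob -[RHS](sum_edge_weight (pairs_in U)); apply: eq_bigr => E _.
by rewrite /comps_in (_ : [forall v in U, true]) ?mulr1 //; apply/forall_inP.
Qed.

Lemma card_setDS U K : K \subset U -> #|U :\: K| = (#|U| - #|K|)%N.
Proof. by move=> KU; rewrite cardsD (setIidPr KU). Qed.

Lemma connected_probE K v : v \in K -> connected_prob K = reach q 1 #|K|.-1.
Proof.
move: {2}#|K| (leqnn #|K|) => m; elim/ltn_ind: m K v => m IH K v lm vK.
have e1 := comps_in_prob_rec xpredT vK; rewrite comps_in_probT in e1.
have cK : #|K| = #|K|.-1.+1 by rewrite prednK // (cardsD1 v K) vK.
have e2 : 1 = \sum_(K' : {set 'I_n} | (K' \subset K) && (v \in K'))
    reach q 1 #|K'|.-1 * q ^+ (#|K'| * (#|K| - #|K'|)).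
  rewrite (sum_card_subset (fun k => reach q 1 k.-1 * q ^+ (k * (#|K| - k))) vK).
  rewrite cK -[LHS](reach_law_sum q 1 #|K|.-1); apply: eq_bigr => j _.
  by rewrite /reach_law add1n subSS mulrA.
(* Two expansions of [1] over the possible components of [v]: they agree on proper subsets of [K] by
   induction, so they agree on [K] itself. *)
have := congr2 (fun x y => x - y) e1 e2; rewrite subrr -sumrB /=.
rewrite (bigD1 K) /= ?subxx ?vK // big1 ?addr0.
  rewrite setDv cards0 subnn !muln0 comps_in_probT expr0 !mulr1 => /esym/eqP.
  by rewrite subr_eq0 => /eqP.
move=> K' /andP[/andP[K'K vK'] nK'].
have pr : K' \proper K by rewrite properEneq nK'.
rewrite comps_in_probT mulr1 card_setDS // (IH #|K'| _ K' v) ?subrr //.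
exact: leq_trans (proper_card pr) lm.
Qed.

Lemma comps_in_probE S U : comps_in_prob S U = cprob q S #|U|.
Proof.
move: {2}#|U| (leqnn #|U|) => m; elim/ltn_ind: m U => m IH U lm.
have [->|[v vU]] := set_0Vmem U.
  rewrite cards0 cprob0 -(comps_in_probT set0) /comps_in_prob; apply: eq_bigr => E _.
  by congr (_ * _%:R); congr nat_of_bool; apply/forall_inP/forall_inP => h x; rewrite inE.
have cU : #|U| = #|U|.-1.+1 by rewrite prednK // (cardsD1 v U) vU.
rewrite (comps_in_prob_rec S vU).
transitivity (\sum_(K : {set 'I_n} | (K \subset U) && (v \in K))
    (if S #|K| then reach q 1 #|K|.-1 * q ^+ (#|K| * (#|U| - #|K|)) *
        cprob q S (#|U| - #|K|) else 0)).
  apply: eq_bigr => K /andP[KU vK]; case: ifP => // SK.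
  have k0 : (0 < #|K|)%N by rewrite (cardsD1 v K) vK.
  rewrite (connected_probE vK) card_setDS // (IH (#|U| - #|K|)%N) ?card_setDS //.
  by apply: leq_trans lm; rewrite ltn_subrL k0 cU.
rewrite (sum_card_subset (fun k => if S k then reach q 1 k.-1 * q ^+ (k * (#|U| - k)) *
        cprob q S (#|U| - k) else 0) vU).
rewrite cU cprobS [RHS]big_mkcond /=; apply: eq_bigr => j _.
case: ifP => _; last by rewrite mulr0.
by rewrite /reach_law add1n subSS !mulrA.
Qed.

End Graph.

(** For a given [W] the event [Vset E r = W] means that no edge joins [W] to its complement, that
    components inside [W] are large and that those outside are small. Only the size of [W] matters,
    which gives the binomial coefficient. *)
Lemma Pna_card_Vset (R : realType) (n : nat) (alpha r : R) (k : nat) :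
  let q := 1 - alpha / n%:R in
  @Pna R n alpha (fun E => #|Vset E r| == k) =
  'C(n, k)%:R * q ^+ (k * (n - k)) * cprob q (fun j => r < j%:R) k
    * cprob q (fun j => j%:R <= r) (n - k).
Proof.
move=> q; set p := alpha / n%:R in q *.
pose S (j : nat) := r < j%:R; pose S' (j : nat) := j%:R <= r.
have prT : pairs_in setT = pairs n by apply/setP => x; rewrite !inE !andbT.
rewrite /Pna (partition_big (fun E => Vset E r) (fun W => #|W| == k)) /=; last first.
  by move=> E /andP[].
rewrite (eq_bigr (fun=> q ^+ (k * (n - k)) * cprob q S k * cprob q S' (n - k))); last first.
  move=> W /eqP cW.
  have KL : [disjoint W & ~: W] by rewrite -setI_eq0 setICr.
  have cC : #|~: W| = (n - k)%N by rewrite cardsCs setCK card_ord cW.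
  transitivity (\sum_(E : {set 'I_n * 'I_n} | E \subset pairs_in W :|: pairs_in (~: W))
     edge_weight p (pairs_in (W :|: ~: W)) E * (Vset E r == W)%:R).
    rewrite setUCr prT big_mkcond [RHS]big_mkcond /=; apply: eq_bigr => E _.
    case: (Vset E r =P W) => eW; rewrite ?mulr0 ?mulr1 ?andbF ?if_same //.
    rewrite eW cW eqxx !andbT /=.
    have -> : (E \subset pairs n) = (E \subset pairs_in W :|: pairs_in (~: W)).
      apply/idP/idP => [EP|h]; last first.
        by apply: subset_trans h _; rewrite -prT subUset !pairs_in_sub ?subsetT.
      have := @edge_pairs_in n E setT (mem W); rewrite prT => /(_ EP).
      have -> : [set i in setT | mem W i] = W by apply/setP => x; rewrite !inE.
      have -> : [set i in setT | ~~ mem W i] = ~: W by apply/setP => x; rewrite !inE.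
      apply=> i j ij /=; rewrite -eW !inE; congr (_ < #|pred_of_set _|%:R).
      by apply/esym/comp_eq; rewrite inE connect1.
    by rewrite /graph_weight /edge_weight.
  rewrite (@sum_edge_weight_union n R p W (~: W) _ (fun E => (comps_in S W E)%:R)
     (fun E => (comps_in S' (~: W) E)%:R)) //; last first.
    move=> E1 E2 h1 h2; rewrite -natrM mulnb; congr (_%:R); congr nat_of_bool.
    have c1 w : w \in W -> comp (E1 :|: E2) w = comp E1 w by apply: comp_union h1 h2 KL.
    have c2 w : w \in ~: W -> comp (E1 :|: E2) w = comp E2 w.
      by rewrite setUC; apply: comp_union h2 h1 _; rewrite disjoint_sym.
    apply/eqP/andP => [e|[/forall_inP g1 /forall_inP g2]].
      split; apply/forall_inP => w wW.
        by rewrite -c1 //; move: wW; rewrite -{1}e inE.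
      by rewrite /S' -c2 // leNgt; move: wW; rewrite inE -{1}e inE.
    apply/setP => w; rewrite inE; have [wW|wW] := boolP (w \in W).
      by rewrite c1 //; apply: g1.
    have wC : w \in ~: W by rewrite inE.
    by rewrite c2 //; apply/negbTE; rewrite -leNgt; apply: g2.
  by rewrite -!/(comps_in_prob p _ _) !comps_in_probE cC cW.
rewrite (eq_bigl (fun W : {set 'I_n} =>
  W \in [set A : {set 'I_n} | A \subset setT & #|A| == k])); last first.
  by move=> W; rewrite inE subsetT.
by rewrite sumr_const cards_draws cardsT card_ord -!mulrA mulr_natl.
Qed.

From mathcomp Require Import all_classical all_reals all_analysis.
Import Order.TTheory GRing.Theory Num.Theory numFieldTopology.Exports numFieldNormedType.Exports.
Local Open Scope classical_set_scope.
Local Open Scope ring_scope.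

(** * Exponential estimates *)

Section RealEstimates.
Variable R : realType.
Implicit Types (a b p x t : R) (m : nat).

(** One term of the exponential series. It lets any polynomial factor be charged to an arbitrarily
    small exponential rate. *)
Lemma near_expR_poly (K tau : R) (a : nat) : 0 < tau ->
  \forall n \near \oo, K * n%:R ^+ a <= expR (n%:R * tau).
Proof.
move=> tau0; set c := tau ^+ a.+1 / a.+1`!%:R.
have c0 : 0 < c by rewrite divr_gt0 ?exprn_gt0 // ltr0n fact_gt0.
near=> n.
have h : 0 <= n%:R * tau by rewrite mulr_ge0 // ltW.
apply: le_trans (expR_ge1Dxn a h); rewrite exprMn -mulrA -/c exprS.
apply: le_trans (_ : n%:R * n%:R ^+ a * c <= _); last by rewrite lerDr.
rewrite mulrAC ler_wpM2r ?exprn_ge0 // -ler_pdivrMr //.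
by near: n; exact: nbhs_infty_ger.
Unshelve. all: by end_near. Qed.

Lemma onem_le_expR p : 1 - p <= expR (- p).
Proof. by have := expR_ge1Dx (- p). Qed.

Lemma onem_ge_expR p : 0 <= p -> p <= 2^-1 -> expR (- (p + 2 * p ^+ 2)) <= 1 - p.
Proof.
move=> p0 p1; have d0 : 0 < 1 - p by lra.
have h1 : p / (1 - p) <= p + 2 * p ^+ 2.
  rewrite ler_pdivrMr //.
  have : 0 <= p ^+ 2 * (1 - 2 * p) by rewrite mulr_ge0 ?exprn_ge0 //; lra.
  by rewrite !expr2 => h; nra.
have h2 : 1 + p / (1 - p) <= expR (p + 2 * p ^+ 2).
  by apply: le_trans (expR_ge1Dx _) _; rewrite ler_expR.
have h3 : 1 + p / (1 - p) = (1 - p)^-1.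
  by rewrite -[X in X + _](divff (lt0r_neq0 d0)) -mulrDl subrK mul1r.
by rewrite expRN -[leRHS]invrK lef_pV2 ?posrE ?expR_gt0 ?invr_gt0 // -h3.
Qed.

Lemma natr_expS_le m : m.+1%:R ^+ m <= expR 1 * m%:R ^+ m :> R.
Proof.
case: m => [|m]; first by rewrite !expr0 mulr1 -expR0 ler_expR.
have m0 : (0 : R) < m.+1%:R by rewrite ltr0n.
have h : m.+2%:R <= m.+1%:R * expR (m.+1%:R^-1) :> R.
  have := expR_ge1Dx (m.+1%:R^-1 : R); rewrite -(ler_pM2l m0) => h'.
  by apply: le_trans h'; rewrite mulrDr mulr1 divff ?lt0r_neq0 // natr1.
apply: le_trans (_ : (m.+1%:R * expR (m.+1%:R^-1)) ^+ m.+1 <= _).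
  by rewrite lerXn2r ?nnegrE ?mulr_ge0 ?expR_ge0.
by rewrite exprMn -expRM_natl divff ?lt0r_neq0 // mulrC.
Qed.

Lemma fact_lb m : m%:R ^+ m <= m`!%:R * expR m%:R :> R.
Proof.
elim: m => [|m IH]; first by rewrite expr0 fact0 expR0 mulr1.
rewrite factS natrM -natr1 expRD exprS natr1 -!mulrA ler_wpM2l //.
apply: le_trans (natr_expS_le m) _.
by rewrite mulrC mulrA ler_wpM2r ?expR_ge0.
Qed.

Lemma fact_ub m : m`!%:R * expR m%:R <= expR 1 * m.+1%:R * m%:R ^+ m :> R.
Proof.
case: m => [|m]; first by rewrite expr0 fact0 expR0 !mulr1 -expR0 ler_expR.
(* For positive integers the induction runs with the integer itself as prefactor; the successor in
   the statement covers [0]. *)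
apply: le_trans (_ : expR 1 * m.+1%:R * m.+1%:R ^+ m.+1 <= _); last first.
  by rewrite ler_wpM2r ?exprn_ge0 // ler_wpM2l ?expR_ge0 // ler_nat.
elim: m => [|m IH]; first by rewrite !mulr1 mul1r.
have -> : expR m.+2%:R = expR m.+1%:R * expR 1 :> R by rewrite -expRD natr1.
rewrite factS natrM.
apply: le_trans (_ : m.+2%:R * (expR 1 * m.+1%:R * m.+1%:R ^+ m.+1) * expR 1 <= _).
  by rewrite mulrA ler_wpM2r ?expR_ge0 // -mulrA ler_wpM2l.
rewrite -!mulrA mulrCA ler_wpM2l ?expR_ge0 // ler_wpM2l // mulrA -exprS.
have m0 : (0 : R) < m.+2%:R by rewrite ltr0n.
have h : m.+1%:R <= m.+2%:R * expR (- m.+2%:R^-1) :> R.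
  have := expR_ge1Dx (- m.+2%:R^-1 : R); rewrite -(ler_pM2l m0) => h'.
  apply: le_trans h'; rewrite mulrDr mulr1 mulrN divff ?lt0r_neq0 //.
  by rewrite -[X in _ <= X - _]natr1 addrK.
apply: le_trans (_ : (m.+2%:R * expR (- m.+2%:R^-1)) ^+ m.+2 * expR 1 <= _).
  by rewrite ler_wpM2r ?expR_ge0 // lerXn2r ?nnegrE ?mulr_ge0 ?expR_ge0.
rewrite exprMn -expRM_natl mulrN divff ?lt0r_neq0 // -mulrA -expRD addNr expR0 mulr1.
by [].
Qed.

Lemma bin2_natr m : 'C(m, 2)%:R = m%:R * (m%:R - 1) / 2 :> R.
Proof.
elim: m => [|m IH]; first by rewrite bin0n mul0r mul0r.
by rewrite binS bin1 natrD IH -natr1; field.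
Qed.

Lemma expR_xlnx (N : R) m : 0 < N ->
  expR (N * (m%:R / N * ln (m%:R / N))) = (m%:R / N) ^+ m.
Proof.
move=> N0; case: m => [|m]; first by rewrite !mul0r mulr0 expR0 expr0.
rewrite mulrA mulrCA divff ?lt0r_neq0 // mulr1 expRM_natl lnK // posrE.
by rewrite divr_gt0 ?ltr0n.
Qed.

Lemma neg_xlnx_le x : 0 <= x -> - (x * ln x) <= 1 - x.
Proof.
rewrite le_eqVlt => /orP[/eqP <-|x0]; first by rewrite mul0r subr0 oppr0.
have := @le_ln1Dx R (x^-1 - 1).
rewrite ltrBrDr addNr invr_gt0 x0 subrKC lnV ?posrE // => /(_ isT).
by rewrite -(ler_pM2l x0) mulrN mulrBr divff ?lt0r_neq0 // mulr1.
Qed.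

(** The difference of the two sides vanishes at [1] and has derivative [ln y + 1 - y <= 0]. Divided
    by [x > 0], it is the expression truncated in [Psi], which is thus nonnegative up to [1]. *)
Lemma xlnx_ge x : 0 <= x -> x <= 1 -> (x ^+ 2 - 1) / 2 <= x * ln x.
Proof.
rewrite le_eqVlt => /orP[/eqP <- _|x0 x1]; first by rewrite mul0r expr0n /=; lra.
pose f (y : R) := y * ln y - (y ^+ 2 - 1) / 2.
have df (y : R) : 0 < y -> is_derive y 1 f (ln y + 1 - y).
  move=> y0; rewrite /f.
  have h := is_derive1_ln y0.
  apply: is_derive_eq.
  rewrite /GRing.scale /= divff ?lt0r_neq0 //.
  by field.
suff : f 1 <= f x.
  by rewrite /f ln1 mulr0 expr1n subrr mul0r subr0 subr_ge0.
have xx : x \in `]0, 1] by rewrite in_itv /= x0 x1.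
have x11 : (1 : R) \in `]0, 1] by rewrite in_itv /= ltr01 lexx.
apply: (@ler0_derive1_le_oc R f 0 1) => //.
  by move=> y; rewrite in_itv /= => /andP[y0 _]; apply: (@ex_derive _ _ _ _ _ _ _ (df y y0)).
  move=> y; rewrite in_itv /= => /andP[y0 y1].
  rewrite derive1E (@derive_val _ _ _ _ _ _ _ (df y y0)).
  have := @le_ln1Dx R (y - 1); rewrite subrKC ltrBrDr addNr => /(_ y0); lra.
apply: derivable_within_continuous => y; rewrite in_itv /= => /andP[y0 _].
exact: (@ex_derive _ _ _ _ _ _ _ (df y y0)).
Qed.

Lemma truncnD_or a b : 0 <= a -> 0 <= b ->
  Num.truncn (a + b) = (Num.truncn a + Num.truncn b)%N \/
  Num.truncn (a + b) = (Num.truncn a + Num.truncn b).+1.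
Proof.
move=> a0 b0; have /andP[a1 a2] := truncn_itv a0; have /andP[b1 b2] := truncn_itv b0.
have [h|h] := ltP (a + b) (Num.truncn a + Num.truncn b).+1%:R.
  left; apply: truncn_def; rewrite h andbT natrD; lra.
right; apply: truncn_def; rewrite h /=.
by move: a2 b2; rewrite -!natr1 natrD; lra.
Qed.

Lemma cvg_truncn_div x : 0 <= x ->
  (Num.truncn (x * n%:R))%:R / n%:R @[n --> \oo] --> x.
Proof.
move=> x0; apply/cvgrPdist_le => e e0; near=> n.
have n0 : (0 : R) < n%:R by near: n; exact: nbhs_infty_gtr.
have xn0 : 0 <= x * n%:R by rewrite mulr_ge0.
have /andP[h1 h2] := truncn_itv xn0.
have ne : e^-1 <= n%:R by near: n; exact: nbhs_infty_ger.
have en : 1 <= e * n%:R by move: ne; rewrite -[e^-1]mul1r ler_pdivrMr // mulrC.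
set t := (Num.truncn _)%:R in h1 *.
have tn : t / n%:R * n%:R = t by rewrite divfK // lt0r_neq0.
rewrite ler_norml; apply/andP; split; rewrite -(ler_pM2r n0) mulrBl tn.
  by rewrite mulNr; lra.
by move: h2; rewrite -natr1 -/t; lra.
Unshelve. all: by end_near. Qed.

End RealEstimates.

Lemma Pna_floor (R : realType) (alpha rho eps : R) (n : nat) : 0 <= rho ->
  @Pna R n alpha (fun E => (#|Vset E (eps * n%:R)|)%:Z == Num.floor (rho * n%:R)) =
  @Pna R n alpha (fun E => #|Vset E (eps * n%:R)| == Num.truncn (rho * n%:R)).
Proof.
move=> r0; apply: eq_bigl => E; congr (_ && _).
have rn0 : 0 <= rho * n%:R by rewrite mulr_ge0.
by rewrite truncn_floor rn0 -eqz_nat gez0_abs // floor_ge0.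
Qed.

(** * Exponential orders of [gam] and [cgam] *)

Section Asymptotics.
Variables (R : realType) (alpha : R).
Hypothesis alpha_gt0 : 0 < alpha.
Implicit Types (n m k : nat) (u x y l tau delta eps eta rho : R).

Let alpha_ge0 := ltW alpha_gt0.

Definition qn n : R := 1 - alpha / n%:R.

(** By Stirling's formula, [gam (qn n) n m] has order [expR (- n gfun (m / n))]; the quadratic term
    comes from the power of [q]. *)
Definition gfun u : R := u * ln u - u - alpha * u ^+ 2 / 2.

(** Exponential order of [cgam] at [y n]: a connected graph contributes [pi1 (alpha y)] per vertex
    besides [gam]. *)
Definition phi y : R := y * ln (pi1 (alpha * y)) - gfun y.

(** The second condition keeps the edge probability at most [1/2], as [onem_ge_expR] demands. *)
Definition large n : bool := (0 < n)%N && (2 * alpha <= n%:R).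

Lemma near_large : \forall n \near \oo, large n.
Proof.
near=> n; apply/andP; split; near: n; [exact: nbhs_infty_gt | exact: nbhs_infty_ger].
Unshelve. all: by end_near. Qed.

Lemma large_gt0 n : large n -> (0 : R) < n%:R.
Proof. by case/andP; rewrite ltr0n. Qed.

Lemma large_p n : large n -> 0 <= alpha / n%:R <= 2^-1.
Proof.
move=> hn; have n0 := large_gt0 hn; case/andP: hn => _ h.
by rewrite divr_ge0 //= ler_pdivrMr // ler_pdivlMl.
Qed.

Lemma qn_gt0 n : large n -> 0 < qn n.
Proof. by move=> /large_p /andP[h1 h2]; rewrite /qn; lra. Qed.

Lemma qn_le1 n : large n -> qn n <= 1.
Proof. by move=> /large_p /andP[h1 h2]; rewrite /qn; lra. Qed.

Lemma qn_ub n k : large n -> qn n ^+ k <= expR (- (alpha * (k%:R / n%:R))).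
Proof.
move=> hn; apply: le_trans (_ : expR (- (alpha / n%:R)) ^+ k <= _).
  by rewrite lerXn2r ?nnegrE ?expR_ge0 ?(ltW (qn_gt0 hn)) // onem_le_expR.
by rewrite -expRM_natl mulrN mulrCA mulrA.
Qed.

Lemma qn_lb n k : large n ->
  expR (- (alpha * (k%:R / n%:R) + 2 * alpha ^+ 2 * k%:R / n%:R ^+ 2)) <= qn n ^+ k.
Proof.
move=> hn; have n0 := large_gt0 hn; have /andP[p0 p1] := large_p hn.
apply: le_trans (_ : expR (- (alpha / n%:R + 2 * (alpha / n%:R) ^+ 2)) ^+ k <= _); last first.
  by rewrite lerXn2r ?nnegrE ?expR_ge0 ?(ltW (qn_gt0 hn)) // onem_ge_expR.
rewrite -expRM_natl le_eqVlt; apply/orP; left; apply/eqP; congr expR.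
by field; rewrite lt0r_neq0.
Qed.

(** [expR (alpha ^+ 2)] pays for the second order term of [qn_lb], summed over at most [n^2 / 2]
    pairs. *)
Lemma gam_ub n m : large n -> (m <= n)%N ->
  gam (qn n) n%:R m <= expR (alpha ^+ 2) * expR (- (n%:R * gfun (m%:R / n%:R))).
Proof.
move=> hn lmn; have n0 := large_gt0 hn; set u := m%:R / n%:R.
have nz : n%:R != 0 :> R by rewrite lt0r_neq0.
have q0 := qn_gt0 hn.
have um : n%:R * u = m%:R by rewrite /u mulrCA divff // mulr1.
have u1 : u <= 1 by rewrite ler_pdivrMr // mul1r ler_nat.
have u0 : 0 <= u by rewrite divr_ge0.
rewrite /gam invfM mulrA.
have -> : expR (alpha ^+ 2) * expR (- (n%:R * gfun u)) =
  expR m%:R / expR (n%:R * (u * ln u)) * expR (n%:R * alpha * u ^+ 2 / 2 + alpha ^+ 2).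
  by rewrite -expRN -!expRD; congr expR; rewrite /gfun -um; ring.
have f0 : (0 : R) < m`!%:R by rewrite ltr0n fact_gt0.
apply: ler_pM.
by rewrite divr_ge0 ?exprn_ge0.
by rewrite invr_ge0 exprn_ge0 ?ltW.
rewrite expR_xlnx //.
  have [->|m0] := posnP m; first by rewrite !expr0 fact0 expR0.
  have um0 : 0 < u ^+ m by rewrite exprn_gt0 // divr_gt0 // ltr0n.
  rewrite ler_pdivrMr // mulrAC ler_pdivlMr // -exprMn um mulrC.
  exact: fact_lb.
rewrite -[leRHS]invrK lef_pV2 ?posrE ?exprn_gt0 ?invr_gt0 ?expR_gt0 // -expRN.
  apply: le_trans (qn_lb _ hn); rewrite ler_expR bin2_natr lerN2.
  have -> : alpha * (m%:R * (m%:R - 1) / 2 / n%:R) = n%:R * alpha * u ^+ 2 / 2 - alpha * u / 2.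
    by rewrite /u; field; rewrite nz.
  have -> : 2 * alpha ^+ 2 * (m%:R * (m%:R - 1) / 2) / n%:R ^+ 2 =
     alpha ^+ 2 * (u ^+ 2 - u / n%:R) by rewrite /u; field; rewrite nz.
  have h1 : u ^+ 2 <= 1 by rewrite exprn_ile1.
  have h2 : 0 <= alpha * u by rewrite mulr_ge0.
  have h3 : alpha ^+ 2 * (u ^+ 2 - u / n%:R) <= alpha ^+ 2.
    rewrite -[leRHS]mulr1 ler_wpM2l ?exprn_ge0 //.
    by apply: le_trans h1; rewrite lerBlDr lerDl divr_ge0.
  by lra.
Qed.

Lemma gam_lb n m : large n -> (m <= n)%N ->
  expR (- (n%:R * gfun (m%:R / n%:R))) <= expR (1 + alpha / 2) * n.+1%:R * gam (qn n) n%:R m.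
Proof.
move=> hn lmn; have n0 := large_gt0 hn; set u := m%:R / n%:R.
have nz : n%:R != 0 :> R by rewrite lt0r_neq0.
have q0 := qn_gt0 hn.
have um : n%:R * u = m%:R by rewrite /u mulrCA divff // mulr1.
have u1 : u <= 1 by rewrite ler_pdivrMr // mul1r ler_nat.
have u0 : 0 <= u by rewrite divr_ge0.
rewrite /gam invfM.
have -> : expR (- (n%:R * gfun u)) =
  expR m%:R / expR (n%:R * (u * ln u)) * (expR (n%:R * alpha * u ^+ 2 / 2 - alpha / 2) *
     expR (alpha / 2)).
  by rewrite -expRN -!expRD; congr expR; rewrite /gfun -um; ring.
have -> : expR (1 + alpha / 2) * n.+1%:R * (n%:R ^+ m * ((m`!%:R)^-1 * (qn n ^+ 'C(m, 2))^-1)) =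
  (expR 1 * n.+1%:R * (n%:R ^+ m / m`!%:R)) * ((qn n ^+ 'C(m, 2))^-1 * expR (alpha / 2)).
  by rewrite expRD; ring.
have f0 : (0 : R) < m`!%:R by rewrite ltr0n fact_gt0.
apply: ler_pM.
by rewrite divr_ge0 ?expR_ge0.
by rewrite mulr_ge0 ?expR_ge0.
rewrite expR_xlnx //.
  apply: le_trans (_ : expR 1 * m.+1%:R * (n%:R ^+ m / m`!%:R) <= _); last first.
    by rewrite ler_wpM2r ?divr_ge0 ?exprn_ge0 // ler_wpM2l ?expR_ge0 // ler_nat ltnS.
  have [->|m0] := posnP m.
    by rewrite !expr0 fact0 expR0 !divr1 !mulr1 -expR0 ler_expR.
  have um0 : 0 < u ^+ m by rewrite exprn_gt0 // divr_gt0 // ltr0n.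
  have e : n%:R ^+ m * (m%:R / n%:R) ^+ m = m%:R ^+ m :> R by rewrite -exprMn um.
  rewrite ler_pdivrMr // -[leRHS]mulrA [_ / _ * _]mulrAC e mulrA ler_pdivlMr // mulrC.
  exact: fact_ub.
rewrite ler_wpM2r ?expR_ge0 //.
  rewrite -[leLHS]invrK lef_pV2 ?posrE ?exprn_gt0 ?invr_gt0 ?expR_gt0 // -expRN.
  apply: le_trans (qn_ub _ hn) _; rewrite ler_expR bin2_natr.
  have -> : alpha * (m%:R * (m%:R - 1) / 2 / n%:R) = n%:R * alpha * u ^+ 2 / 2 - alpha * u / 2.
    by rewrite /u; field; rewrite nz.
  have : alpha * u <= alpha by rewrite -[leRHS]mulr1 ler_wpM2l.
  by lra.
Qed.

Lemma pi1_gt0 y : 0 < y -> 0 < pi1 (alpha * y).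
Proof. by move=> y0; rewrite subr_gt0 expR_lt1 oppr_lt0 mulr_gt0. Qed.

Lemma pi1_le1 (x : R) : pi1 x <= 1.
Proof. by rewrite lerBlDr lerDl expR_ge0. Qed.

Lemma pi1_le (x x' : R) : x <= x' -> pi1 x <= pi1 x'.
Proof. by move=> h; rewrite lerD2l lerN2 ler_expR lerN2. Qed.

Lemma expR_pi1 n k : large n -> (0 < k)%N ->
  expR (n%:R * (k%:R / n%:R * ln (pi1 (alpha * (k%:R / n%:R))))) =
  pi1 (alpha * (k%:R / n%:R)) ^+ k.
Proof.
move=> hn k0; have n0 := large_gt0 hn.
rewrite mulrA mulrCA divff ?lt0r_neq0 // mulr1 expRM_natl lnK // posrE.
by rewrite pi1_gt0 // divr_gt0 // ltr0n.
Qed.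

Lemma conn_lb n k : large n ->
  pi1 (alpha * (k.+1%:R / n%:R)) ^+ k.+1 <= k.+1%:R * reach (qn n) 1 k.
Proof.
move=> hn; have q0 := ltW (qn_gt0 hn); have q1 := qn_le1 hn.
have n0 := large_gt0 hn.
have := reach_ge q0 q1 1 k; rewrite mul1r add1n; apply: le_trans.
have p0 : 0 <= pi1 (alpha * (k.+1%:R / n%:R)).
  by rewrite ltW // pi1_gt0 // divr_gt0 // ltr0n.
apply: le_trans (_ : pi1 (alpha * (k.+1%:R / n%:R)) ^+ k <= _).
  by rewrite exprS -[leRHS]mul1r ler_wpM2r ?exprn_ge0 ?pi1_le1.
rewrite lerXn2r ?nnegrE // ?subr_ge0 ?exprn_ile1 //.
by rewrite lerD2l lerN2 qn_ub.
Qed.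

(** Replacing [1 - q^k] by [pi1] costs an additive error of order [1/n]. The lower bound [delta] on
    [k / n] makes it a relative error, whose [k]-th power stays bounded. *)
Lemma one_sub_qn_le n k delta : large n -> 0 < delta -> (k <= n)%N ->
  delta <= k%:R / n%:R ->
  (1 - qn n ^+ k) ^+ k <= expR (2 * alpha ^+ 2 / pi1 (alpha * delta)) *
     pi1 (alpha * (k%:R / n%:R)) ^+ k.
Proof.
move=> hn d0 lkn ldk; have n0 := large_gt0 hn; set y := k%:R / n%:R in ldk *.
have q0 := ltW (qn_gt0 hn); have q1 := qn_le1 hn.
have y0 : 0 < y by apply: lt_le_trans ldk.
have y1 : y <= 1 by rewrite ler_pdivrMr // mul1r ler_nat.
set P := pi1 (alpha * y); set P0 := pi1 (alpha * delta).
have P00 : 0 < P0 by apply: pi1_gt0.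
have PP : P0 <= P by apply: pi1_le; rewrite ler_wpM2l.
have P1 : 0 < P by apply: lt_le_trans PP.
set c := 2 * alpha ^+ 2 / n%:R.
have c0 : 0 <= c by rewrite /c divr_ge0 // mulr_ge0 ?exprn_ge0.
have h1 : 1 - qn n ^+ k <= P + c.
  have := qn_lb k hn; rewrite -/y opprD expRD => h.
  have e : 2 * alpha ^+ 2 * k%:R / n%:R ^+ 2 = c * y.
    by rewrite /c /y; field; rewrite lt0r_neq0.
  rewrite e in h.
  have h2 := expR_ge1Dx (- (c * y)).
  have E0 := expR_gt0 (- (alpha * y)).
  have E1 : expR (- (alpha * y)) <= 1 by rewrite expR_le1 oppr_le0 mulr_ge0 // ltW.
  have h3 : expR (- (alpha * y)) * (1 - c) <= qn n ^+ k.
    apply: le_trans h; rewrite ler_wpM2l ?(ltW E0) //; apply: le_trans h2.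
    by rewrite lerD2l lerN2 -[leRHS]mulr1 ler_wpM2l.
  have h4 : expR (- (alpha * y)) * c <= c by rewrite -[leRHS]mul1r ler_wpM2r.
  by rewrite /P /pi1; lra.
have h2 : P + c <= P * expR (c / P0).
  have := expR_ge1Dx (c / P0); rewrite -(ler_pM2l P1); apply: le_trans.
  rewrite mulrDr mulr1 lerD2l mulrCA -[leLHS]mulr1 ler_wpM2l //.
  by rewrite ler_pdivlMr // mul1r.
apply: le_trans (_ : (P * expR (c / P0)) ^+ k <= _).
  rewrite lerXn2r ?nnegrE ?subr_ge0 ?exprn_ile1 //; last exact: le_trans h2.
  by rewrite mulr_ge0 ?expR_ge0 ?ltW.
rewrite exprMn mulrC ler_wpM2r ?exprn_ge0 ?(ltW P1) // -expRM_natl ler_expR.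
have -> : k%:R * (c / P0) = y * (2 * alpha ^+ 2 / P0).
  by rewrite /c /y; field; rewrite !lt0r_neq0.
by rewrite -[leRHS]mul1r ler_wpM2r // divr_ge0 ?(ltW P00) // mulr_ge0 ?exprn_ge0.
Qed.

(** The exponent [k] of [reach_le] is raised to [k + 1] at the price of a factor at least
    [pi1 (alpha delta)], to obtain the form that [cprob_large_le] asks for. *)
Lemma conn_ub n k delta : large n -> 0 < delta -> (k.+1 <= n)%N ->
  delta <= k.+1%:R / n%:R ->
  reach (qn n) 1 k <= (pi1 (alpha * delta))^-1 * (1 - qn n ^+ k.+1) ^+ k.+1.
Proof.
move=> hn d0 lkn ldk.
have q0 := ltW (qn_gt0 hn); have q1 := qn_le1 hn.
apply: le_trans (reach_le q0 q1 1 k) _; rewrite add1n ler_pdivlMl ?pi1_gt0 //.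
rewrite [leRHS]exprS ler_wpM2r ?exprn_ge0 ?subr_ge0 ?exprn_ile1 //.
apply: le_trans (_ : pi1 (alpha * (k.+1%:R / n%:R)) <= _).
  by apply: pi1_le; rewrite ler_wpM2l.
by rewrite lerD2l lerN2 qn_ub.
Qed.

Lemma near_gam tau : 0 < tau -> \forall n \near \oo, forall m, (m <= n)%N ->
  expR (n%:R * (- gfun (m%:R / n%:R) - tau)) <= gam (qn n) n%:R m
    <= expR (n%:R * (- gfun (m%:R / n%:R) + tau)).
Proof.
move=> t0; near=> n => m lmn.
have hn : large n by near: n; exact: near_large.
have e1 : expR (alpha ^+ 2) <= expR (n%:R * tau).
  by have : expR (alpha ^+ 2) * n%:R ^+ 0 <= expR (n%:R * tau);
    [near: n; exact: near_expR_poly | rewrite expr0 mulr1].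
have e2 : expR (1 + alpha / 2) * n.+1%:R <= expR (n%:R * tau).
  have : (expR (1 + alpha / 2) * 2) * n%:R ^+ 1 <= expR (n%:R * tau).
    by near: n; exact: near_expR_poly.
  apply: le_trans; rewrite expr1 -mulrA ler_wpM2l ?expR_ge0 //.
  by case/andP: hn => n0 _; rewrite -natrM ler_nat; lia.
apply/andP; split.
  rewrite mulrBr expRB mulrN ler_pdivrMr ?expR_gt0 //.
  have q0 := qn_gt0 hn; have g0 := gam_gt0 q0 (large_gt0 hn) m.
  by apply: le_trans (gam_lb hn lmn) _; rewrite mulrC ler_pM2l.
rewrite mulrDr mulrN expRD; apply: le_trans (gam_ub hn lmn) _.
by rewrite mulrC ler_wpM2l ?expR_ge0.
Unshelve. all: by end_near. Qed.

Lemma near_cgam_lb tau : 0 < tau -> \forall n \near \oo, forall k, (0 < k)%N -> (k <= n)%N ->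
  expR (n%:R * (phi (k%:R / n%:R) - tau)) <= cgam (qn n) n%:R k.
Proof.
move=> t0; have t2 : 0 < tau / 2 by lra.
near=> n => k k0 lkn.
have hn : large n by near: n; exact: near_large.
have /andP[hg _] : expR (n%:R * (- gfun (k%:R / n%:R) - tau / 2)) <= gam (qn n) n%:R k
    <= expR (n%:R * (- gfun (k%:R / n%:R) + tau / 2)).
  by move: k lkn {k0}; near: n; exact: near_gam.
have e1 : n%:R <= expR (n%:R * (tau / 2)).
  by have : 1 * n%:R ^+ 1 <= expR (n%:R * (tau / 2));
    [near: n; exact: near_expR_poly | rewrite expr1 mul1r].
case: k k0 lkn hg => // k _ lkn hg; rewrite /cgam /=.
have -> : n%:R * (phi (k.+1%:R / n%:R) - tau) =
  (n%:R * (k.+1%:R / n%:R * ln (pi1 (alpha * (k.+1%:R / n%:R)))) - n%:R * (tau / 2)) +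
   n%:R * (- gfun (k.+1%:R / n%:R) - tau / 2) by rewrite /phi; field; rewrite lt0r_neq0 // large_gt0.
rewrite expRD ler_pM ?expR_ge0 // expRD expR_pi1 // expRN ler_pdivrMr ?expR_gt0 //.
apply: le_trans (conn_lb _ hn) _; rewrite mulrC.
have q0 := ltW (qn_gt0 hn); have q1 := qn_le1 hn.
rewrite ler_wpM2l ?reach_ge0 //; apply: le_trans e1; by rewrite ler_nat.
Unshelve. all: by end_near. Qed.

Lemma near_cgam_ub tau delta : 0 < tau -> 0 < delta ->
  \forall n \near \oo, forall k, delta * n%:R <= k%:R -> (k <= n)%N ->
  cgam (qn n) n%:R k <= expR (n%:R * (phi (k%:R / n%:R) + tau)).
Proof.
move=> t0 d0; have t2 : 0 < tau / 2 by lra.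
near=> n => k ldk lkn.
have hn : large n by near: n; exact: near_large.
have n0 := large_gt0 hn.
have /andP[_ hg] : expR (n%:R * (- gfun (k%:R / n%:R) - tau / 2)) <= gam (qn n) n%:R k
    <= expR (n%:R * (- gfun (k%:R / n%:R) + tau / 2)).
  by move: k lkn {ldk}; near: n; exact: near_gam.
have e1 : (pi1 (alpha * delta))^-1 * expR (2 * alpha ^+ 2 / pi1 (alpha * delta))
     <= expR (n%:R * (tau / 2)).
  have : (pi1 (alpha * delta))^-1 * expR (2 * alpha ^+ 2 / pi1 (alpha * delta)) * n%:R ^+ 0
     <= expR (n%:R * (tau / 2)); last by rewrite expr0 mulr1.
  by near: n; exact: near_expR_poly.
have k0 : (0 : R) < k%:R by apply: lt_le_trans ldk; rewrite mulr_gt0.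
case: k k0 ldk lkn hg => [|k]; first by rewrite ltxx.
move=> _ ldk lkn hg; rewrite /cgam /=.
have ldk' : delta <= k.+1%:R / n%:R by rewrite ler_pdivlMr.
have q0 := ltW (qn_gt0 hn); have q1 := qn_le1 hn.
have -> : n%:R * (phi (k.+1%:R / n%:R) + tau) =
  (n%:R * (k.+1%:R / n%:R * ln (pi1 (alpha * (k.+1%:R / n%:R)))) + n%:R * (tau / 2)) +
   n%:R * (- gfun (k.+1%:R / n%:R) + tau / 2) by rewrite /phi; field; rewrite lt0r_neq0.
rewrite expRD ler_pM ?reach_ge0 //; first by rewrite ltW ?gam_gt0 ?qn_gt0.
rewrite expRD expR_pi1 //; apply: le_trans (conn_ub hn d0 lkn ldk') _.
apply: le_trans (ler_wpM2l _ (one_sub_qn_le hn d0 lkn ldk')) _.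
  by rewrite invr_ge0 ltW ?pi1_gt0.
rewrite [leLHS]mulrA [leRHS]mulrC ler_wpM2r // exprn_ge0 // ltW // pi1_gt0 //.
by rewrite divr_gt0 // ltr0n.
Unshelve. all: by end_near. Qed.

(** From [1 - exp(-x) >= x exp(-x)]. The linear part is the slope of the critical tangent; for
    pieces of size [delta n] the quadratic loss per vertex is of order [delta]. *)
Lemma phi_ge y : 0 < y -> y * (1 + ln alpha) - alpha * y ^+ 2 / 2 <= phi y.
Proof.
move=> y0; have ay : 0 < alpha * y by rewrite mulr_gt0.
have h : alpha * y * expR (- (alpha * y)) <= pi1 (alpha * y).
  have := expR_ge1Dx (alpha * y).
  rewrite -(ler_pM2r (expR_gt0 (- (alpha * y)))) expRxMexpNx_1 mulrDl mul1r /pi1.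
  by lra.
move: h; rewrite -ler_ln ?posrE ?pi1_gt0 ?mulr_gt0 ?expR_gt0 //.
rewrite !lnM ?posrE ?mulr_gt0 ?expR_gt0 // expRK.
rewrite -(ler_pM2l y0) /phi /gfun => h'.
nra.
Qed.

(** * Graphs without large components *)

Definition small_h eps n m : R :=
  hcprob (qn n) n%:R (fun k => k%:R <= eps * n%:R) m.

(* [fcrit u] is [u Psi(alpha u)] before truncation at [0]. *)
Definition fcrit u : R := u * ln (alpha * u) - alpha * u ^+ 2 / 2 + (2 * alpha)^-1.

Definition psi u : R := Num.min (fcrit u) 0.

(** The right-hand side is the tangent line of [- gfun] at [1 / alpha]. *)
Lemma fcrit_sub_gfun u : 0 <= u ->
  fcrit u - gfun u = u * (1 + ln alpha) + (2 * alpha)^-1.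
Proof.
rewrite le_eqVlt => /orP[/eqP <-|u0]; rewrite /fcrit /gfun.
  by rewrite !mul0r expr0n /= !mulr0 mul0r; ring.
by rewrite lnM ?posrE //; ring.
Qed.

Lemma fcrit_ge0 u : 0 <= u -> alpha * u <= 1 -> 0 <= fcrit u.
Proof.
move=> u0 au; have := xlnx_ge (mulr_ge0 alpha_ge0 u0) au.
have az : alpha != 0 by rewrite lt0r_neq0.
have -> : fcrit u = alpha^-1 * (alpha * u * ln (alpha * u) - ((alpha * u) ^+ 2 - 1) / 2).
  by rewrite /fcrit; field.
by move=> h; rewrite mulr_ge0 ?invr_ge0 // subr_ge0.
Qed.

Lemma psi_le0 u : psi u <= 0.
Proof. by rewrite ge_min lexx orbT. Qed.

Lemma psi_le_fcrit u : psi u <= fcrit u.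
Proof. by rewrite ge_min lexx. Qed.

Lemma gfun_scaled u : 0 < u -> - gfun u - u * (1 + ln alpha) =
  alpha^-1 * (- (alpha * u * ln (alpha * u)) + (alpha * u) ^+ 2 / 2).
Proof.
move=> u0; have az : alpha != 0 by rewrite lt0r_neq0.
by rewrite /gfun lnM ?posrE //; field.
Qed.

(** The mean component size is at most [1 / s] while the threshold is [delta n], so each vertex
    costs a factor [1 - O(1/n)] and all together only a constant. *)
Lemma near_small_h_subcritical delta s tau : 0 < delta -> 0 < s -> s < 1 -> 0 < tau ->
  \forall n \near \oo, forall m, (m <= n)%N -> alpha * (m%:R / n%:R) <= 1 - s ->
  expR (n%:R * (- gfun (m%:R / n%:R) - tau)) <= small_h delta n m.
Proof.
move=> d0 s0 s1 t0; have t2 : 0 < tau / 2 by lra.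
near=> n => m lmn hm.
have hn : large n by near: n; exact: near_large.
have n0 := large_gt0 hn.
have q0 := qn_gt0 hn; have q1 := qn_le1 hn.
have nz : n%:R != 0 :> R by rewrite lt0r_neq0.
have /andP[hg _] : expR (n%:R * (- gfun (m%:R / n%:R) - tau / 2)) <= gam (qn n) n%:R m
    <= expR (n%:R * (- gfun (m%:R / n%:R) + tau / 2)).
  by move: m lmn {hm}; near: n; exact: near_gam.
have e : m%:R * (1 - qn n) = alpha * (m%:R / n%:R) by rewrite /qn; field.
have h1 : m%:R * (1 - qn n) < 1 by rewrite e; lra.
set t := (delta * n%:R * (1 - m%:R * (1 - qn n)))^-1.
have ds : 0 < delta * n%:R * s by rewrite !mulr_gt0.
have tle : t <= (delta * n%:R * s)^-1.
  rewrite /t lef_pV2 ?posrE // ?mulr_gt0 ?subr_gt0 // ler_wpM2l ?mulr_ge0 ?(ltW d0) ?(ltW n0) //.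
  by rewrite e; lra.
have n1 : 2 / (delta * s) <= n%:R by near: n; exact: nbhs_infty_ger.
have t12 : (delta * n%:R * s)^-1 <= 2^-1.
  rewrite lef_pV2 ?posrE //; move: n1; rewrite ler_pdivrMr ?mulr_gt0 //.
  by rewrite mulrCA mulrA.
have t0' : 0 <= t by rewrite invr_ge0 mulr_ge0 ?(ltW (mulr_gt0 d0 n0)) // subr_ge0 ltW.
have h2 : t <= 1 by lra.
have := @cprob_subcritical R (qn n) q0 q1 (delta * n%:R) m m (mulr_gt0 d0 n0) (leqnn m) h1 h2.
rewrite -/t => hc.
have n2 : 4 / (delta * s) / tau <= n%:R by near: n; exact: nbhs_infty_ger.
have hc' : expR (- (n%:R * (tau / 2))) <= cprob (qn n) (fun k => k%:R <= delta * n%:R) m.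
  apply: le_trans hc; apply: le_trans (_ : expR (- (t + 2 * t ^+ 2)) ^+ m <= _).
    rewrite -expRM_natl ler_expR mulrN lerN2.
    have tt : t + 2 * t ^+ 2 <= 2 * t.
      by have : t * t <= t * 2^-1; [rewrite ler_wpM2l //; lra | rewrite expr2; lra].
    apply: le_trans (_ : n%:R * (2 * (delta * n%:R * s)^-1) <= _).
      by rewrite ler_pM ?addr_ge0 ?mulr_ge0 ?exprn_ge0 ?ler_nat //; lra.
    have -> : n%:R * (2 * (delta * n%:R * s)^-1) = 2 / (delta * s).
      by field; rewrite nz !lt0r_neq0.
    by move: n2; rewrite ler_pdivrMr //; lra.
  rewrite lerXn2r ?nnegrE ?expR_ge0 //; first by rewrite subr_ge0.
  by apply: onem_ge_expR => //; lra.
rewrite /small_h /hcprob.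
have -> : n%:R * (- gfun (m%:R / n%:R) - tau) =
  - (n%:R * (tau / 2)) + n%:R * (- gfun (m%:R / n%:R) - tau / 2) by field.
by rewrite expRD ler_pM ?expR_ge0.
Unshelve. all: by end_near. Qed.

Lemma near_small_h_lb eta : 0 < eta -> exists2 d0 : R, 0 < d0 &
  forall delta, 0 < delta -> delta < d0 -> \forall n \near \oo, forall m, (m <= n)%N ->
  expR (n%:R * (psi (m%:R / n%:R) - gfun (m%:R / n%:R) - eta)) <= small_h delta n m.
Proof.
move=> eta0.
pose s : R := Num.min (2^-1) (alpha * eta / 8).
have ae : 0 < alpha * eta by rewrite mulr_gt0.
have s0 : 0 < s by rewrite lt_min; apply/andP; split; lra.
have s12 : s <= 2^-1 by rewrite ge_min lexx.
have sae : s <= alpha * eta / 8 by rewrite ge_min lexx orbT.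
(* The first bound makes a piece smaller than any supercritical graph, the second limits the loss at
   the end of the removal, the third the total loss of slope. *)
exists (Num.min (1 / (4 * alpha)) (Num.min (eta / 8) (eta / (2 * (alpha + 1))))).
  by rewrite !lt_min !divr_gt0 // ?mulr_gt0 // addr_gt0.
move=> delta d0; rewrite !lt_min => /and3P[dl1 dl2 dl3].
have ad : alpha * delta < 1 / 4.
  by move: dl1; rewrite !ltr_pdivlMr ?mulr_gt0 //; lra.
have ad3 : (alpha + 1) * delta < eta / 2.
  by move: dl3; rewrite ltr_pdivlMr ?mulr_gt0 ?addr_gt0 //; lra.
pose t1 : R := eta / 8. have t10 : 0 < t1 by rewrite /t1; lra.
pose t2 : R := delta ^+ 2 / 8. have t20 : 0 < t2 by rewrite divr_gt0 ?exprn_gt0.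
have s1 : s < 1 by lra.
near=> n => m lmn.
have hn : large n by near: n; exact: near_large.
have n0 := large_gt0 hn.
have nz : n%:R != 0 :> R by rewrite lt0r_neq0.
have q0 := qn_gt0 hn; have q1 := qn_le1 hn.
have hsub m' : (m' <= n)%N -> alpha * (m'%:R / n%:R) <= 1 - s ->
  expR (n%:R * (- gfun (m'%:R / n%:R) - t1)) <= small_h delta n m'.
  by move: m'; near: n; exact: near_small_h_subcritical.
have hcg k : (0 < k)%N -> (k <= n)%N ->
  expR (n%:R * (phi (k%:R / n%:R) - t2)) <= cgam (qn n) n%:R k.
  by move: k; near: n; exact: near_cgam_lb.
have [hm|hm] := leP (alpha * (m%:R / n%:R)) (1 - s).
  apply: le_trans (hsub m lmn hm); rewrite ler_expR ler_wpM2l ?(ltW n0) //.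
  by have := psi_le0 (m%:R / n%:R); rewrite /t1; lra.
set k := Num.truncn (delta * n%:R).
have dn0 : 0 <= delta * n%:R by rewrite mulr_ge0 ?ltW.
have /andP[kle kgt] := truncn_itv dn0; rewrite -/k in kle kgt.
have n1 : 2 / delta <= n%:R by near: n; exact: nbhs_infty_ger.
have dn2 : 2 <= delta * n%:R by move: n1; rewrite ler_pdivrMr // mulrC.
have khalf : delta * n%:R / 2 <= k%:R by move: kgt; rewrite -natr1; lra.
have k0 : (0 < k)%N by rewrite -(ltr_nat R); apply: lt_le_trans khalf; lra.
have e3 : n%:R <= expR (n%:R * t2).
  by have : 1 * n%:R ^+ 1 <= expR (n%:R * t2);
    [near: n; exact: near_expR_poly | rewrite expr1 mul1r].
(* The tangent slope less a loss per removed vertex: [alpha * delta] pays for the quadratic term of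
   [phi_ge], [delta] for the factor [m'] and the error [t2]. *)
set Lam := 1 + ln alpha - (alpha + 1) * delta.
pose y : R := k%:R / n%:R.
have ny : n%:R * y = k%:R by rewrite /y mulrCA divff // mulr1.
have y0 : 0 < y by rewrite divr_gt0 // ltr0n.
have yd : y <= delta by rewrite ler_pdivrMr.
(* Each removal lowers the scaled size by [alpha * y], so the window from [1 - s - alpha * y] to
   [1 - s] cannot be jumped over; inside it the subcritical bound is close to the tangent line. *)
have key : forall m', (m' <= n)%N -> alpha * (m'%:R / n%:R) > 1 - s - alpha * y ->
  expR (n%:R * ((2 * alpha)^-1 - eta / 2) + m'%:R * Lam) <= small_h delta n m'.
  elim/ltn_ind => m' IH lm' hm'.
  have [hle|hgt] := leP (alpha * (m'%:R / n%:R)) (1 - s).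
    apply: le_trans (hsub m' lm' hle); rewrite ler_expR.
    set u := m'%:R / n%:R in hle hm' *.
    have nu : n%:R * u = m'%:R by rewrite /u mulrCA divff // mulr1.
    have ay : alpha * y <= alpha * delta by rewrite ler_wpM2l.
    have au0 : 0 < alpha * u by lra.
    have u0 : 0 < u by move: au0; rewrite pmulr_rgt0.
    rewrite -nu -mulrA -mulrDr ler_wpM2l ?(ltW n0) //.
    have := gfun_scaled u0.
    have l0 : ln (alpha * u) <= 0 by apply: ln_le0; lra.
    have l1 : 0 <= - (alpha * u * ln (alpha * u)) by rewrite -mulrN mulr_ge0 ?oppr_ge0 // ltW.
    have sq : 1 - 2 * (s + alpha * delta) <= (alpha * u) ^+ 2.
      have : 0 <= (1 - alpha * u) ^+ 2 by rewrite sqr_ge0.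
      by rewrite !expr2; nra.
    have i0 : 0 < alpha^-1 by rewrite invr_gt0.
    have l2 : alpha^-1 * ((1 - 2 * (s + alpha * delta)) / 2) <=
      alpha^-1 * (- (alpha * u * ln (alpha * u)) + (alpha * u) ^+ 2 / 2).
      by rewrite ler_wpM2l ?(ltW i0) //; lra.
    have l3 : alpha^-1 * ((1 - 2 * (s + alpha * delta)) / 2) =
       (2 * alpha)^-1 - s / alpha - delta by field; rewrite lt0r_neq0.
    have l4 : s / alpha <= eta / 8 by rewrite ler_pdivrMr //; lra.
    have l5 : 0 <= u * ((alpha + 1) * delta) by rewrite !mulr_ge0 ?addr_ge0 // ltW.
    by rewrite l3 in l2; rewrite /Lam /t1; lra.
  have km : (k <= m')%N.
    rewrite -(ler_nat R).
    have : 1 - s < alpha * m'%:R / n%:R by rewrite -mulrA.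
    rewrite ltr_pdivlMr // => h.
    have : delta * n%:R <= m'%:R; last by lra.
    have h' : alpha * delta * n%:R <= 1 / 4 * n%:R by rewrite ler_wpM2r // ltW.
    have h'' : 2^-1 * n%:R <= (1 - s) * n%:R by rewrite ler_wpM2r //; lra.
    by rewrite -(ler_pM2l alpha_gt0); lra.
  have m0 : (0 < m')%N by apply: leq_trans km.
  have lmk : (m' - k <= n)%N by apply: leq_trans (leq_subr _ _) lm'.
  have := IH (m' - k)%N _ lmk _; rewrite ltn_subrL k0 m0 natrB // => /(_ isT).
  have -> : alpha * ((m'%:R - k%:R) / n%:R) = alpha * (m'%:R / n%:R) - alpha * y.
    by rewrite /y; ring.
  rewrite ltrD2r => /(_ hgt) {}IH.
  have := @hcprob_ge_term R (qn n) q0 q1 n%:R n0 (fun j => j%:R <= delta * n%:R) m' k kle km.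
  rewrite -/(small_h delta n m') -/(small_h delta n (m' - k)) => hstep.
  have m0' : (0 : R) < m'%:R by rewrite ltr0n.
  rewrite -(ler_pM2l m0'); apply: le_trans hstep.
  have kge1 : (1 : R) <= k%:R by rewrite ler1n.
  have mn : m'%:R <= expR (n%:R * t2) by apply: le_trans e3; rewrite ler_nat.
  apply: le_trans (ler_wpM2r (expR_ge0 _) mn) _.
  have cg := hcg k k0 (leq_trans km lm').
  apply: le_trans (_ : expR (n%:R * (phi y - t2)) *
      expR (n%:R * ((2 * alpha)^-1 - eta / 2) + (m'%:R - k%:R) * Lam) <= _); last first.
    apply: ler_pM; rewrite ?expR_ge0 //.
    apply: le_trans (cg) _; rewrite -[leLHS]mul1r ler_wpM2r //.
    by apply: le_trans cg; rewrite expR_ge0.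
  rewrite -!expRD ler_expR.
  have ph := phi_ge y0.
  have ph' : n%:R * (y * (1 + ln alpha) - alpha * y ^+ 2 / 2) <= n%:R * phi y.
    by rewrite ler_wpM2l // ltW.
  have e1 : n%:R * (y * (1 + ln alpha) - alpha * y ^+ 2 / 2) =
     k%:R * (1 + ln alpha) - k%:R * (alpha * y) / 2 by rewrite -ny; ring.
  rewrite e1 in ph'.
  have e2 : k%:R * (alpha * y) <= k%:R * (alpha * delta).
    by rewrite ler_wpM2l // ler_wpM2l.
  have e4 : n%:R * t2 <= k%:R * delta / 4.
    by rewrite /t2; have := ler_wpM2l (ltW d0) khalf; rewrite expr2; lra.
  have e5 : 0 <= k%:R * (alpha * delta) by rewrite !mulr_ge0 // ltW.
  have e6 : 0 <= k%:R * delta by rewrite mulr_ge0 // ltW.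
  by rewrite /Lam; lra.
have hm' : 1 - s - alpha * y < alpha * (m%:R / n%:R).
  by apply: le_lt_trans hm; rewrite lerBlDr lerDl mulr_ge0 // ltW.
apply: le_trans (key m lmn hm'); rewrite ler_expR.
set u := m%:R / n%:R.
have nu : n%:R * u = m%:R by rewrite /u mulrCA divff // mulr1.
rewrite -nu -mulrA -mulrDr ler_wpM2l ?(ltW n0) //.
have u0 : 0 <= u by rewrite divr_ge0.
have u1 : u <= 1 by rewrite ler_pdivrMr // mul1r ler_nat.
have f1 := fcrit_sub_gfun u0; have f2 := psi_le_fcrit u.
have f3 : u * ((alpha + 1) * delta) <= (alpha + 1) * delta.
  by rewrite -[leRHS]mul1r ler_wpM2r // mulr_ge0 ?addr_ge0 // ltW.
by rewrite /Lam; lra.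
Unshelve. all: by end_near. Qed.

Lemma near_small_h_ub eta : 0 < eta -> exists2 d0 : R, 0 < d0 &
  forall delta, 0 < delta -> delta < d0 -> \forall n \near \oo, forall m, (m <= n)%N ->
  small_h delta n m <= expR (n%:R * (psi (m%:R / n%:R) - gfun (m%:R / n%:R) + eta)).
Proof.
move=> eta0.
exists (Num.min (1 / (4 * alpha)) (Num.min (eta / 8) (eta / (12 * alpha)))).
  by rewrite !lt_min !divr_gt0 // ?mulr_gt0.
move=> delta d0; rewrite !lt_min => /and3P[dl1 dl2 dl3].
have ad : alpha * delta < 1 / 4.
  by move: dl1; rewrite !ltr_pdivlMr ?mulr_gt0 //; lra.
have ad3 : alpha * delta < eta / 12.
  by move: dl3; rewrite ltr_pdivlMr ?mulr_gt0 //; lra.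
have ad0 : 0 < alpha * delta by rewrite mulr_gt0.
pose t1 : R := eta / 8. have t10 : 0 < t1 by rewrite /t1; lra.
near=> n => m lmn.
have hn : large n by near: n; exact: near_large.
have n0 := large_gt0 hn.
have nz : n%:R != 0 :> R by rewrite lt0r_neq0.
have q0 := qn_gt0 hn; have q1 := qn_le1 hn.
have hg m' : (m' <= n)%N -> gam (qn n) n%:R m' <= expR (n%:R * (- gfun (m'%:R / n%:R) + t1)).
  move=> lm'; have : expR (n%:R * (- gfun (m'%:R / n%:R) - t1)) <= gam (qn n) n%:R m'
    <= expR (n%:R * (- gfun (m'%:R / n%:R) + t1)); last by case/andP.
  by move: m' lm'; near: n; exact: near_gam.
have hgam : small_h delta n m <= expR (n%:R * (- gfun (m%:R / n%:R) + t1)).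
  by apply: le_trans (hg m lmn); apply: hcprob_le_gam.
set u := m%:R / n%:R in hgam *.
have nu : n%:R * u = m%:R by rewrite /u mulrCA divff // mulr1.
have u0 : 0 <= u by rewrite divr_ge0.
have u1 : u <= 1 by rewrite ler_pdivrMr // mul1r ler_nat.
have [au|au] := leP (alpha * u) 1.
  apply: le_trans hgam _; rewrite ler_expR ler_wpM2l ?(ltW n0) //.
  by rewrite /psi (min_idPr (fcrit_ge0 u0 au)) /t1; lra.
suff : small_h delta n m <= expR (n%:R * (fcrit u - gfun u + eta)).
  move=> h; rewrite /psi; case: (leP (fcrit u) 0) => _ //.
  by apply: le_trans hgam _; rewrite ler_expR ler_wpM2l ?(ltW n0) // /t1; lra.
set r := Num.truncn (delta * n%:R).
have dn0 : 0 <= delta * n%:R by rewrite mulr_ge0 ?ltW.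
have /andP[rle rgt] := truncn_itv dn0; rewrite -/r in rle rgt.
have na0 : 0 <= n%:R / alpha by rewrite divr_ge0.
(* The first integer above the critical size. *)
set M := (Num.truncn (n%:R / alpha)).+1.
have /andP[Mle Mgt] := truncn_itv na0; rewrite -/M in Mgt.
have M1 : (0 < M)%N by [].
have rM : (r < M)%N.
  rewrite -(ltr_nat R); apply: le_lt_trans rle _; apply: le_lt_trans Mgt.
  by rewrite ler_pdivlMr //; have := ler_wpM2r (ltW n0) (ltW ad); lra.
have n1 : 2 / delta <= n%:R by near: n; exact: nbhs_infty_ger.
have dn2 : 2 <= delta * n%:R by move: n1; rewrite ler_pdivrMr // mulrC.
(* At the critical size the ratio [n / ((i+1) q^i)] is about [alpha e]. Of the slack,
   [2 alpha delta] allows [i] to lie up to [delta n] below [n / alpha], and the rest replaces [q^i]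
   by [exp(-1)]. *)
set lam := alpha * expR (1 + 3 * (alpha * delta)).
(* The tangent line at [0] has height [1 / (2 alpha)]; [delta] and [t1] are slack. *)
set F := expR (n%:R * ((2 * alpha)^-1 + delta + t1)).
have lam0 : 0 < lam by rewrite mulr_gt0 ?expR_gt0.
have lamE j : lam ^+ j = expR (j%:R * (1 + ln alpha + 3 * (alpha * delta))).
  rewrite expRM_natl; congr (_ ^+ _).
  by rewrite [1 + ln _]addrC -addrA expRD lnK ?posrE.
have range i : (M - r <= i)%N -> (i < M)%N ->
  [/\ alpha * (i%:R / n%:R) <= 1, 1 - alpha * delta <= alpha * (i%:R / n%:R) & (0 < i)%N].
  move=> Mi iM.
  have i0 : (0 < i)%N by apply: leq_trans Mi; rewrite subn_gt0.
  have iM' : i%:R <= n%:R / alpha.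
    by apply: le_trans Mle; rewrite ler_nat -ltnS.
  have Mi' : M%:R - r%:R <= i%:R :> R by rewrite -natrB ?ler_nat // ltnW.
  split=> //.
    by rewrite mulrA ler_pdivrMr // mul1r mulrC -ler_pdivlMr.
  rewrite mulrA ler_pdivlMr //.
  have h1 : n%:R / alpha - delta * n%:R <= i%:R by lra.
  have h2 := ler_wpM2l alpha_ge0 h1.
  have e : alpha * (n%:R / alpha - delta * n%:R) = (1 - alpha * delta) * n%:R.
    by field; rewrite lt0r_neq0.
  by rewrite e in h2.
have Mm : (M <= m)%N.
  rewrite /M (@truncn_lt_nat R _ m na0) ltr_pdivrMr // -nu -mulrA [u * _]mulrC.
  by rewrite ltr_pMr.
have mM : (M - r <= m)%N by apply: leq_trans (leq_subr _ _) Mm.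
have F0 : 0 <= F by rewrite expR_ge0.
have super : small_h delta n m <= F * lam ^+ m.
  apply: (@hcprob_supersolution R (qn n) q0 q1 n%:R n0 _ lam F M r m) => //.
  by move=> k hk; rewrite truncn_ge_nat.
  move=> i Mi iM; have [h1 h2 i0] := range i Mi iM.
    have hq := @qn_lb n i hn.
    set v := i%:R / n%:R in h1 h2 hq.
    have nv : n%:R * v = i%:R by rewrite /v mulrCA divff // mulr1.
    have e1 : 2 * alpha ^+ 2 * i%:R / n%:R ^+ 2 <= alpha * delta.
      have -> : 2 * alpha ^+ 2 * i%:R / n%:R ^+ 2 = (2 * alpha / n%:R) * (alpha * v).
        by rewrite -nv; field.
      have p0 : 0 <= 2 * alpha / n%:R by rewrite divr_ge0 ?mulr_ge0.
      apply: le_trans (_ : 2 * alpha / n%:R * 1 <= _); first by rewrite ler_wpM2l.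
      rewrite mulr1 ler_pdivrMr //; have := ler_wpM2l alpha_ge0 dn2; lra.
    have hq' : expR (- (1 + alpha * delta)) <= qn n ^+ i.
      by apply: le_trans hq; rewrite ler_expR lerN2; lra.
    have hd : expR (- (2 * (alpha * delta))) <= 1 - alpha * delta.
      apply: le_trans (onem_ge_expR _ _); [|lra|lra].
      rewrite ler_expR lerN2 expr2.
      have : alpha * delta * (alpha * delta) <= alpha * delta * (1 / 4).
        by rewrite ler_wpM2l // ltW.
      by lra.
    have hi : (1 - alpha * delta) * n%:R <= alpha * i.+1%:R.
      apply: le_trans (_ : alpha * i%:R <= _); last by rewrite ler_wpM2l // ler_nat.
      by rewrite -nv mulrCA mulrC ler_wpM2l // ltW.
    have prod : expR (- (1 + 3 * (alpha * delta))) <= (1 - alpha * delta) * qn n ^+ i.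
      have -> : - (1 + 3 * (alpha * delta)) = - (2 * (alpha * delta)) + - (1 + alpha * delta) by ring.
      by rewrite expRD ler_pM ?expR_ge0.
    rewrite /lam.
    apply: le_trans (_ : n%:R * (expR (1 + 3 * (alpha * delta)) *
        ((1 - alpha * delta) * qn n ^+ i)) <= _).
      rewrite -[leLHS]mulr1 ler_wpM2l ?(ltW n0) // -[leLHS](expRxMexpNx_1 (1 + 3 * (alpha * delta))).
      by rewrite ler_wpM2l ?expR_ge0.
    have -> : n%:R * (expR (1 + 3 * (alpha * delta)) * ((1 - alpha * delta) * qn n ^+ i)) =
      (expR (1 + 3 * (alpha * delta)) * qn n ^+ i) * ((1 - alpha * delta) * n%:R) by ring.
    have -> : alpha * expR (1 + 3 * (alpha * delta)) * (i.+1%:R * qn n ^+ i) =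
      (expR (1 + 3 * (alpha * delta)) * qn n ^+ i) * (alpha * i.+1%:R) by ring.
    by rewrite ler_wpM2l // mulr_ge0 ?expR_ge0 // exprn_ge0 // ltW.
  move=> i Mi iM; have [h1 h2 i0] := range i Mi iM.
    have lin : (i <= n)%N by apply: leq_trans (ltnW (leq_trans iM Mm)) lmn.
    apply: le_trans (hg i lin) _.
    set v := i%:R / n%:R in h1 h2 *.
    have nv : n%:R * v = i%:R by rewrite /v mulrCA divff // mulr1.
    have v0 : 0 < v by rewrite divr_gt0 // ltr0n.
    rewrite lamE /F -expRD ler_expR -nv -mulrA -mulrDr ler_wpM2l ?(ltW n0) //.
    have := gfun_scaled v0.
    have l1 := neg_xlnx_le (mulr_ge0 alpha_ge0 (ltW v0)).
    have sq : (alpha * v) ^+ 2 <= 1 by rewrite exprn_ile1 // mulr_ge0 // ltW.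
    have l2 : alpha^-1 * (- (alpha * v * ln (alpha * v)) + (alpha * v) ^+ 2 / 2) <=
        alpha^-1 * (alpha * delta + 1 / 2) by rewrite ler_wpM2l ?invr_ge0 //; lra.
    have l3 : alpha^-1 * (alpha * delta + 1 / 2) = delta + (2 * alpha)^-1.
      by field; rewrite lt0r_neq0.
    have l4 : 0 <= v * (3 * (alpha * delta)) by rewrite !mulr_ge0 // ltW.
    by rewrite l3 in l2; lra.
apply: le_trans super _; rewrite lamE /F -expRD ler_expR -nu -mulrA -mulrDr ler_wpM2l ?(ltW n0) //.
have f1 := fcrit_sub_gfun u0.
have f3 : u * (3 * (alpha * delta)) <= 3 * (alpha * delta).
  by rewrite -[leRHS]mul1r ler_wpM2r // mulr_ge0 // ltW.
by rewrite /t1; lra.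
Unshelve. all: by end_near. Qed.

Lemma cvg_gfun (w : nat -> R) x : 0 < x -> w n @[n --> \oo] --> x ->
  gfun (w n) @[n --> \oo] --> gfun x.
Proof.
move=> x0 hw; rewrite /gfun.
have hl : ln (w n) @[n --> \oo] --> ln x.
  by apply: continuous_cvg; [exact: continuous_ln | exact: hw].
apply: cvgB; first by apply: cvgB => //; apply: cvgM.
by apply: cvgMl; apply: cvgMr; rewrite expr2; under eq_cvg do rewrite expr2; apply: cvgM.
Qed.

Lemma cvg_phi (w : nat -> R) x : 0 < x -> w n @[n --> \oo] --> x ->
  phi (w n) @[n --> \oo] --> phi x.
Proof.
move=> x0 hw; rewrite /phi; apply: cvgB; last exact: cvg_gfun.
apply: cvgM => //; apply: continuous_cvg; first exact: continuous_ln (pi1_gt0 x0).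
rewrite /pi1; apply: cvgB; first exact: cvg_cst.
apply: continuous_cvg; first exact: continuous_expR.
by apply: cvgN; apply: cvgMr.
Qed.

(** The logarithm is singular at [0]; there the sequence is assumed constant, as it is for rounded
    multiples of [x = 0]. *)
Lemma cvg_psi_sub_gfun (w : nat -> R) x : 0 <= x -> w n @[n --> \oo] --> x ->
  (x = 0 -> forall n, w n = 0) ->
  psi (w n) - gfun (w n) @[n --> \oo] --> psi x - gfun x.
Proof.
rewrite le_eqVlt => /orP[/eqP x0 _ h|x0 hw _].
  by under eq_cvg do rewrite h //; rewrite -x0; exact: cvg_cst.
apply: cvgB; last exact: cvg_gfun.
have hf : fcrit (w n) @[n --> \oo] --> fcrit x.
  rewrite /fcrit; apply: cvgD; last exact: cvg_cst.
  apply: cvgB.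
    apply: cvgM => //; apply: continuous_cvg; last exact: cvgMr.
    by apply: continuous_ln; rewrite mulr_gt0.
  by apply: cvgMl; apply: cvgMr; rewrite expr2; under eq_cvg do rewrite expr2; apply: cvgM.
have minE (a : R) : Num.min a 0 = (a - `|a|) / 2.
  by case: (leP a 0) => h; [rewrite ler0_norm // | rewrite gtr0_norm //]; field.
rewrite /psi minE; under eq_cvg do rewrite minE.
by apply: cvgMl; apply: cvgB => //; apply: cvg_norm.
Qed.

Lemma small_h_le delta eps n m : large n -> delta <= eps ->
  small_h delta n m <= small_h eps n m.
Proof.
move=> hn de; have n0 := large_gt0 hn.
have q0 := qn_gt0 hn; have q1 := qn_le1 hn.
rewrite ler_wpM2r ?(ltW (gam_gt0 q0 n0 m)) //.
apply: cprob_le => // k; move/le_trans; apply.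
by rewrite ler_wpM2r ?(ltW n0).
Qed.

Lemma small_hS_ge eps n m : large n -> 1 <= eps * n%:R -> (m < n)%N ->
  small_h eps n m <= small_h eps n m.+1.
Proof.
move=> hn e1 mn; have n0 := large_gt0 hn.
have q0 := qn_gt0 hn; have q1 := qn_le1 hn.
have := @hcprob_ge_term R (qn n) q0 q1 n%:R n0 (fun j => j%:R <= eps * n%:R) m.+1 1 e1 isT.
rewrite subSS subn0 cgam1 mul1r -/(small_h eps n m) -/(small_h eps n m.+1) => h.
have z0 : 0 <= small_h eps n m.+1 by apply: hcprob_ge0.
rewrite -(ler_pM2l n0); apply: le_trans h _.
by rewrite ler_wpM2r // ler_nat.
Qed.

Lemma small_hS_le eps n m : large n -> (m < n)%N ->
  small_h eps n m.+1 <= expR (2 * alpha) * n%:R ^+ 2 * small_h eps n m.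
Proof.
move=> hn mn; have n0 := large_gt0 hn.
have q0 := qn_gt0 hn; have q1 := qn_le1 hn.
have z0 : 0 <= small_h eps n m by apply: hcprob_ge0.
have := @hcprobS_le R (qn n) q0 q1 n%:R n0 (fun j => j%:R <= eps * n%:R) m.
rewrite -/(small_h eps n m) -/(small_h eps n m.+1) => h.
apply: le_trans (h _) _ => [k|]; first by apply: le_trans; rewrite ler_nat.
rewrite ler_wpM2r // mulrAC expr2 mulrA ler_wpM2r ?(ltW n0) //.
rewrite mulrC ler_pM ?invr_ge0 ?exprn_ge0 ?(ltW q0) //; last by rewrite ler_nat.
rewrite -[leRHS]invrK lef_pV2 ?posrE ?exprn_gt0 ?invr_gt0 ?expR_gt0 // -expRN.
apply: le_trans (qn_lb m hn); rewrite ler_expR lerN2.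
set u := m%:R / n%:R.
have u1 : u <= 1 by rewrite ler_pdivrMr // mul1r ler_nat ltnW.
have u0 : 0 <= u by rewrite divr_ge0.
have -> : 2 * alpha ^+ 2 * m%:R / n%:R ^+ 2 = alpha * ((2 * alpha / n%:R) * u).
  by rewrite /u; field; rewrite lt0r_neq0.
have h2 : 2 * alpha / n%:R <= 1.
  by rewrite ler_pdivrMr // mul1r; case/andP: hn.
have h3 : (2 * alpha / n%:R) * u <= 1.
  by rewrite -[leRHS]mulr1 ler_pM ?divr_ge0 ?mulr_ge0.
have h4 := ler_wpM2l alpha_ge0 h3; have h5 := ler_wpM2l alpha_ge0 u1.
by lra.
Qed.

(** * Graphs without small components *)

Definition large_h eps n m : R :=
  hcprob (qn n) n%:R (fun k => eps * n%:R < k%:R) m.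

(** Below, the connected graphs alone suffice. Above, [cprob_large_le] applies with
    [T = expR (tau / 3)]: components exceed [eps n], so one factor [T^k] already dominates [K n]. *)
Lemma near_large_h eps tau : 0 < eps -> 0 < tau ->
  \forall n \near \oo, forall m, (m <= n)%N -> eps * n%:R < m%:R ->
  expR (n%:R * (phi (m%:R / n%:R) - tau)) <= large_h eps n m
    <= expR (n%:R * (phi (m%:R / n%:R) + tau)).
Proof.
move=> e0 t0; have t3 : 0 < tau / 3 by lra.
have et : 0 < eps * (tau / 3) by rewrite mulr_gt0.
near=> n => m lmn hm.
have hn : large n by near: n; exact: near_large.
have n0 := large_gt0 hn.
have q0 := qn_gt0 hn; have q1 := qn_le1 hn.
have en0 : 0 < eps * n%:R by rewrite mulr_gt0.
case: m lmn hm => [|m] lmn hm; first by have := lt_trans en0 hm; rewrite ltxx.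
have g0 := gam_gt0 q0 n0 m.+1.
apply/andP; split.
  apply: le_trans (_ : cgam (qn n) n%:R m.+1 <= _).
    by move: m lmn {hm g0} => m; move: (isT : (0 < m.+1)%N); move: m.+1; near: n; exact: near_cgam_lb.
  by rewrite ler_wpM2r ?(ltW g0) //; apply: reach_le_cprob.
have /andP[_ hg] : expR (n%:R * (- gfun (m.+1%:R / n%:R) - tau / 3)) <= gam (qn n) n%:R m.+1
    <= expR (n%:R * (- gfun (m.+1%:R / n%:R) + tau / 3)).
  by move: m.+1 lmn; near: n; exact: near_gam.
set K := (pi1 (alpha * eps))^-1.
have K0 : 0 <= K by rewrite invr_ge0 ltW ?pi1_gt0.
have h1 : K * n%:R <= expR (n%:R * (eps * (tau / 3))).
  by rewrite -[X in K * X]expr1; near: n; exact: near_expR_poly.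
have h2 : expR (2 * alpha ^+ 2 / pi1 (alpha * eps)) <= expR (n%:R * (tau / 3)).
  have : expR (2 * alpha ^+ 2 / pi1 (alpha * eps)) * n%:R ^+ 0 <= expR (n%:R * (tau / 3)).
    by near: n; exact: near_expR_poly.
  by rewrite expr0 mulr1.
have epsle k : eps * n%:R < k%:R -> eps <= k%:R / n%:R.
  by move=> h; rewrite ler_pdivlMr // ltW.
have hc := @cprob_large_le R (qn n) q0 q1 (fun k => eps * n%:R < k%:R) K (expR (tau / 3))
  n m.+1 K0 (expR_ge0 _) _ _ lmn.
have {hc} hc : cprob (qn n) (fun k => eps * n%:R < k%:R) m.+1 <=
   expR (tau / 3) ^+ m.+1 * (1 - qn n ^+ m.+1) ^+ m.+1.
  apply: hc => k hk lkn; first exact: conn_ub (epsle _ hk).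
  apply: le_trans h1 _; rewrite -expRM_natl ler_expR mulrA ler_wpM2r ?(ltW t3) //.
  by rewrite mulrC ltW.
have hs := one_sub_qn_le hn e0 lmn (epsle _ hm).
set y := m.+1%:R / n%:R in hg hs *.
have -> : n%:R * (phi y + tau) = n%:R * (tau / 3) + (n%:R * (tau / 3) +
   n%:R * (y * ln (pi1 (alpha * y)))) + n%:R * (- gfun y + tau / 3).
  by rewrite /phi; field.
rewrite expRD ler_pM ?cprob_ge0 ?(ltW g0) // expRD.
apply: le_trans hc _; rewrite ler_pM ?exprn_ge0 ?expR_ge0 ?subr_ge0 ?exprn_ile1 ?(ltW q0) //.
  by rewrite -expRM_natl ler_expR ler_wpM2r ?(ltW t3) // ler_nat.
rewrite expRD expR_pi1 //; apply: le_trans hs _.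
rewrite ler_wpM2r // exprn_ge0 // ltW // pi1_gt0 //.
by rewrite divr_gt0 // ltr0n.
Unshelve. all: by end_near. Qed.

(** * Existence of the limit for fixed [eps] *)

(** The supremum of this set is the lower exponential growth rate along the rounded sizes, obtained
    without assuming that a limit exists. *)
Definition lower_rates eps x : set R :=
  [set l | \forall n \near \oo, expR (n%:R * l) <= small_h eps n (Num.truncn (x * n%:R))].

(* The limit for fixed [eps], for which no closed formula is needed. *)
Definition rate eps x : R := sup (lower_rates eps x).

Lemma truncn_le_n x n : 0 <= x <= 1 -> (Num.truncn (x * n%:R) <= n)%N.
Proof.
move=> /andP[x0 x1]; rewrite -(ler_nat R); apply: le_trans (_ : x * n%:R <= _).
  by rewrite truncn_le mulr_ge0.
by rewrite -[leRHS]mul1r ler_wpM2r.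
Qed.

Lemma truncn_div_eq0 x n : x = 0 -> (Num.truncn (x * n%:R))%:R / n%:R = 0 :> R.
Proof. by move=> ->; rewrite mul0r truncn0 mul0r. Qed.

Lemma lower_rates_psi eps x eta : 0 < eps -> 0 <= x <= 1 -> 0 < eta ->
  lower_rates eps x (psi x - gfun x - eta).
Proof.
move=> e0 x01 eta0; have /andP[x0 x1] := x01.
have eta2 : 0 < eta / 2 by lra.
have [d0 d00 hd] := near_small_h_lb eta2.
pose delta := Num.min (d0 / 2) eps.
have de0 : 0 < delta by rewrite lt_min e0 andbT; lra.
have ded : delta < d0 by rewrite gt_min; apply/orP; left; lra.
have dee : delta <= eps by rewrite ge_min lexx orbT.
have c1 := cvg_psi_sub_gfun x0 (cvg_truncn_div x0) (fun e n => truncn_div_eq0 n e).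
rewrite /lower_rates /=; near=> n.
have hn : large n by near: n; exact: near_large.
apply: le_trans (small_h_le _ hn dee).
set m := Num.truncn _.
have lmn : (m <= n)%N by apply: truncn_le_n.
apply: le_trans (_ : expR (n%:R * (psi (m%:R / n%:R) - gfun (m%:R / n%:R) - eta / 2)) <= _).
  rewrite ler_expR ler_wpM2l //.
  have : `|psi x - gfun x - (psi (m%:R / n%:R) - gfun (m%:R / n%:R))| <= eta / 2.
    by rewrite /m; near: n; move/cvgrPdist_le: c1; apply.
  by rewrite ler_norml => /andP[]; lra.
by move: m lmn; near: n; exact: hd.
Unshelve. all: by end_near. Qed.

Lemma lower_rates_le eps x l : 0 <= x <= 1 -> lower_rates eps x l -> l <= 2 + alpha.
Proof.
move=> x01 hl; near \oo => n.
have hn : large n by near: n; exact: near_large.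
have n0 := large_gt0 hn.
have q0 := qn_gt0 hn; have q1 := qn_le1 hn.
have h1 : expR (n%:R * l) <= small_h eps n (Num.truncn (x * n%:R)) by near: n.
have lmn := truncn_le_n n x01; set m := Num.truncn _ in h1 lmn.
have /andP[_ h2] : expR (n%:R * (- gfun (m%:R / n%:R) - 1)) <= gam (qn n) n%:R m
    <= expR (n%:R * (- gfun (m%:R / n%:R) + 1)).
  by move: m lmn {h1}; near: n; exact: near_gam.
have := le_trans h1 (le_trans (hcprob_le_gam q0 q1 n0 _ _) h2).
rewrite ler_expR ler_pM2l // => /le_trans; apply.
set u := m%:R / n%:R.
have u1 : u <= 1 by rewrite ler_pdivrMr // mul1r ler_nat.
have u0 : 0 <= u by rewrite divr_ge0.
have := neg_xlnx_le u0.
have h3 : alpha * u ^+ 2 <= alpha by rewrite -[leRHS]mulr1 ler_wpM2l // exprn_ile1.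
rewrite /gfun => h4.
have h5 := alpha_ge0.
lra.
Unshelve. all: by end_near. Qed.

Lemma lower_rates_down eps x l l' : l' <= l -> lower_rates eps x l -> lower_rates eps x l'.
Proof.
move=> ll; rewrite /lower_rates /=; apply: filterS => n; apply: le_trans.
by rewrite ler_expR ler_wpM2l.
Qed.

Lemma lower_rates_has_sup eps x : 0 < eps -> 0 <= x <= 1 -> has_sup (lower_rates eps x).
Proof.
move=> e0 x01; split.
  by exists (psi x - gfun x - 1); apply: lower_rates_psi.
by exists (2 + alpha) => l; apply: lower_rates_le.
Qed.

Lemma lower_rates_le_rate eps x l : 0 < eps -> 0 <= x <= 1 ->
  lower_rates eps x l -> l <= rate eps x.
Proof. by move=> e0 x01 hl; apply: sup_upper_bound => //; apply: lower_rates_has_sup. Qed.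

Lemma lower_rates_lt_rate eps x l : 0 < eps -> 0 <= x <= 1 ->
  l < rate eps x -> lower_rates eps x l.
Proof.
move=> e0 x01 hl; have h : 0 < rate eps x - l by rewrite subr_gt0.
have [l' hl' ll'] := sup_adherent h (lower_rates_has_sup e0 x01).
by apply: lower_rates_down hl'; rewrite -/(rate eps x) in ll'; lra.
Qed.

Lemma rate_ge_psi eps x : 0 < eps -> 0 <= x <= 1 -> psi x - gfun x <= rate eps x.
Proof.
move=> e0 x01; apply/ler_addgt0Pr => eta eta0.
have := lower_rates_le_rate e0 x01 (lower_rates_psi e0 x01 eta0); lra.
Qed.

(** Splits off one component of about [y n] vertices. The rounded sizes may fail to add up by one;
    an isolated vertex makes up for it. *)
Lemma lower_rates_step eps x y l eta : 0 < eps -> x <= 1 -> 0 < y -> y <= eps -> y <= x ->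
  0 < eta -> lower_rates eps (x - y) l -> lower_rates eps x (phi y + l - eta).
Proof.
move=> e0 x1 y0 ye yx eta0 hl.
have eta3 : 0 < eta / 3 by lra.
have x01 : 0 <= x <= 1 by rewrite x1 andbT; lra.
have xy01 : 0 <= x - y <= 1 by apply/andP; split; lra.
have y01 : 0 <= y <= 1 by apply/andP; split; lra.
have c1 := cvg_phi y0 (cvg_truncn_div (ltW y0)).
rewrite /lower_rates /=; near=> n.
have hn : large n by near: n; exact: near_large.
have n0 := large_gt0 hn.
have q0 := qn_gt0 hn; have q1 := qn_le1 hn.
have h1 : expR (n%:R * l) <= small_h eps n (Num.truncn ((x - y) * n%:R)) by near: n.
have en : 1 <= eps * n%:R.
  have : 1 / eps <= n%:R by near: n; exact: nbhs_infty_ger.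
  by rewrite ler_pdivrMr // mulrC.
have yn : 1 <= y * n%:R.
  have : 1 / y <= n%:R by near: n; exact: nbhs_infty_ger.
  by rewrite ler_pdivrMr // mulrC.
have lkn := truncn_le_n n y01.
have hphi : `|phi y - phi ((Num.truncn (y * n%:R))%:R / n%:R)| <= eta / 3.
  by near: n; move/cvgrPdist_le: c1; apply.
have e3 : n%:R <= expR (n%:R * (eta / 3)).
  by have : 1 * n%:R ^+ 1 <= expR (n%:R * (eta / 3));
    [near: n; exact: near_expR_poly | rewrite expr1 mul1r].
have k0 : (0 < Num.truncn (y * n%:R))%N by rewrite truncn_gt0.
have kle : (Num.truncn (y * n%:R))%:R <= eps * n%:R.
  apply: le_trans (_ : y * n%:R <= _); first by rewrite truncn_le mulr_ge0 // ltW.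
  by rewrite ler_wpM2r.
have cg : expR (n%:R * (phi ((Num.truncn (y * n%:R))%:R / n%:R) - eta / 3)) <=
   cgam (qn n) n%:R (Num.truncn (y * n%:R)).
  move: (Num.truncn (y * n%:R)) k0 lkn {kle hphi}; near: n; exact: near_cgam_lb.
have lmn := truncn_le_n n x01.
set k := Num.truncn (y * n%:R) in lkn hphi k0 kle cg.
set m' := Num.truncn ((x - y) * n%:R) in h1.
set m := Num.truncn (x * n%:R) in lmn *.
have mE : m = (k + m')%N \/ m = (k + m').+1.
  have -> : m = Num.truncn (y * n%:R + (x - y) * n%:R) by rewrite -mulrDl subrKC.
  apply: truncnD_or; first by rewrite mulr_ge0 // ltW.
  by rewrite mulr_ge0 //; lra.
have km : (k <= m)%N by case: mE => ->; rewrite ?leqW // leq_addr.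
have h2 : expR (n%:R * l) <= small_h eps n (m - k).
  apply: le_trans h1 _; case: mE lmn => ->; first by rewrite addKn.
  rewrite -addnS addKn => lmn; apply: small_hS_ge => //.
  by apply: leq_trans lmn; rewrite leq_addl.
have := @hcprob_ge_term R (qn n) q0 q1 n%:R n0 (fun j => j%:R <= eps * n%:R) m k kle km.
rewrite -/(small_h eps n m) -/(small_h eps n (m - k)) => hstep.
have m0 : (0 : R) < m%:R by rewrite ltr0n (leq_trans k0).
rewrite -(ler_pM2l m0); apply: le_trans hstep.
have mn : m%:R <= expR (n%:R * (eta / 3)) by apply: le_trans e3; rewrite ler_nat.
apply: le_trans (ler_wpM2r (expR_ge0 _) mn) _.
apply: le_trans (_ : expR (n%:R * (phi (k%:R / n%:R) - eta / 3)) * expR (n%:R * l) <= _); last first.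
  apply: ler_pM; rewrite ?expR_ge0 //; apply: le_trans (cg) _.
  rewrite -[leLHS]mul1r ler_wpM2r ?ler1n //.
  by apply: le_trans cg; rewrite expR_ge0.
rewrite -!expRD ler_expR -!mulrDr ler_wpM2l //.
by move: hphi; rewrite ler_norml => /andP[]; lra.
Unshelve. all: by end_near. Qed.

Lemma rate_step eps x y : 0 < eps -> x <= 1 -> 0 < y -> y <= eps -> y <= x ->
  phi y + rate eps (x - y) <= rate eps x.
Proof.
move=> e0 x1 y0 ye yx; apply/ler_addgt0Pr => eta eta0.
have x01 : 0 <= x <= 1 by rewrite x1 andbT; lra.
have xy01 : 0 <= x - y <= 1 by apply/andP; split; lra.
have eta2 : 0 < eta / 2 by lra.
have h : rate eps (x - y) - eta / 2 < rate eps (x - y) by lra.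
have := lower_rates_lt_rate e0 xy01 h.
move=> /(lower_rates_step e0 x1 y0 ye yx eta2) /(lower_rates_le_rate e0 x01); lra.
Qed.

(** [rate] is superadditive under removal of a piece ([rate_step]), hence a supersolution of the
    split at [delta n]; graphs with components up to [delta n] lie below it by [rate_ge_psi]. *)
Lemma near_small_h_le_rate eps eta : 0 < eps -> 0 < eta ->
  \forall n \near \oo, forall m, (m <= n)%N ->
  small_h eps n m <= expR (n%:R * (rate eps (m%:R / n%:R) + eta)).
Proof.
move=> e0 eta0; have eta4 : 0 < eta / 4 by lra.
have eta2 : 0 < eta / 2 by lra.
have [d0 d00 hd] := near_small_h_ub eta4.
pose delta := Num.min (d0 / 2) eps.
have de0 : 0 < delta by rewrite lt_min e0 andbT; lra.
have ded : delta < d0 by rewrite gt_min; apply/orP; left; lra.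
have dee : delta <= eps by rewrite ge_min lexx orbT.
pose t2 := eta * delta / 4.
have t20 : 0 < t2 by rewrite divr_gt0 ?mulr_gt0.
near=> n => m lmn.
have hn : large n by near: n; exact: near_large.
have n0 := large_gt0 hn.
have nz : n%:R != 0 :> R by rewrite lt0r_neq0.
have q0 := qn_gt0 hn; have q1 := qn_le1 hn.
have hs m' : (m' <= n)%N -> small_h delta n m' <=
   expR (n%:R * (psi (m'%:R / n%:R) - gfun (m'%:R / n%:R) + eta / 4)).
  by move: m'; near: n; exact: hd.
have hcg k : delta * n%:R <= k%:R -> (k <= n)%N ->
   cgam (qn n) n%:R k <= expR (n%:R * (phi (k%:R / n%:R) + t2)).
  by move: k; near: n; exact: near_cgam_ub.
have x1 : 2 <= expR (n%:R * (eta / 4)).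
  by have : 2 * n%:R ^+ 0 <= expR (n%:R * (eta / 4));
    [near: n; exact: near_expR_poly | rewrite expr0 mulr1].
have x2 : 2 * n.+1%:R <= expR (n%:R * t2).
  have : 4 * n%:R ^+ 1 <= expR (n%:R * t2) by near: n; exact: near_expR_poly.
  apply: le_trans; rewrite expr1 -!natrM ler_nat.
  by case/andP: hn => n0' _; clear - n0'; lia.
have u01 m' : (m' <= n)%N -> 0 <= (m'%:R / n%:R : R) <= 1.
  by move=> lm'; rewrite divr_ge0 //= ler_pdivrMr // mul1r ler_nat.
(* The term [m' (eta / 2)] keeps errors from accumulating: a removed piece has more than [delta n]
   vertices and frees more than [2 n t2], the cost of [hcg] and of the number of terms. *)
suff key : forall m', (m' <= n)%N -> small_h eps n m' <=
    expR (n%:R * (rate eps (m'%:R / n%:R) + eta / 2) + m'%:R * (eta / 2)).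
  apply: le_trans (key m lmn) _; rewrite ler_expR.
  have : m%:R * (eta / 2) <= n%:R * (eta / 2) by rewrite ler_wpM2r ?(ltW eta2) // ler_nat.
  by lra.
elim/ltn_ind => m' IH lm'; set X := expR _.
have := @hcprob_split_le R (qn n) q0 q1 n%:R n0 (fun j => j%:R <= eps * n%:R)
  (fun j => j%:R <= delta * n%:R) m' _.
rewrite -/(small_h eps n m') -/(small_h delta n m') => hsplit.
apply: le_trans (hsplit _) _ => [k h|].
  by apply: le_trans h _; rewrite ler_wpM2r.
have X0 : 0 < X by rewrite expR_gt0.
have part1 : small_h delta n m' <= X / 2.
  rewrite ler_pdivlMr //.
  apply: le_trans (ler_pM _ _ (hs m' lm') x1) _ => //; first exact: hcprob_ge0.
  rewrite -expRD /X ler_expR -mulrDr.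
  have := rate_ge_psi e0 (u01 m' lm') => h.
  apply: le_trans (_ : n%:R * (rate eps (m'%:R / n%:R) + eta / 2) <= _).
    by rewrite ler_wpM2l //; lra.
  by rewrite lerDl mulr_ge0 // ltW.
have part2 : \sum_(k < m'.+1 | (k%:R <= eps * n%:R) && ~~ (k%:R <= delta * n%:R))
   cgam (qn n) n%:R k * hcprob (qn n) n%:R (fun j => j%:R <= eps * n%:R) (m' - k) <= X / 2.
  apply: le_trans (_ : \sum_(k < m'.+1) X / (2 * n.+1%:R) <= _); last first.
    rewrite sumr_const card_ord -[leLHS]mulr_natr.
    have -> : X / 2 = X / (2 * n.+1%:R) * n.+1%:R.
      by field; rewrite nat1r pnatr_eq0.
    by rewrite ler_wpM2l ?ler_nat ?ltnS // divr_ge0 ?(ltW X0) // mulr_ge0.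
  rewrite big_mkcond; apply: ler_sum => -[k lk] _ /=; case: ifP => [/andP[k1 k2]|_]; last first.
    by rewrite divr_ge0 ?(ltW X0) // mulr_ge0.
  rewrite ltnS in lk.
  rewrite -ltNge in k2.
  have k0 : (0 : R) < k%:R by apply: le_lt_trans k2; rewrite mulr_ge0 // ltW.
  have lkn := leq_trans lk lm'.
  have k0' : (0 < k)%N by rewrite -(ltr_nat R).
  rewrite ler_pdivlMr ?mulr_gt0 ?ltr0n // mulrAC.
  have c1 := hcg k (ltW k2) lkn.
  have lmk : (m' - k <= n)%N by apply: leq_trans (leq_subr _ _) lm'.
  have c2 := IH (m' - k)%N _ lmk; rewrite ltn_subrL k0' (leq_trans k0' lk) in c2.
  have {}c2 := c2 isT.
  have cg0 : 0 <= cgam (qn n) n%:R k by apply: cgam_ge0.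
  apply: le_trans (ler_pM _ (hcprob_ge0 q0 q1 n0 _ _) (ler_pM cg0 _ c1 x2) c2) _ => //.
    by rewrite mulr_ge0 // mulr_ge0.
  rewrite -!expRD /X ler_expR.
  set v := m'%:R / n%:R.
  have e1 : (m' - k)%:R / n%:R = v - k%:R / n%:R :> R.
    by rewrite natrB // mulrBl.
  rewrite e1 natrB //.
  have st : phi (k%:R / n%:R) + rate eps (v - k%:R / n%:R) <= rate eps v.
    apply: rate_step => //; first by have /andP[] := u01 m' lm'.
    by rewrite divr_gt0.
    by rewrite ler_pdivrMr.
    by rewrite /v ler_wpM2r ?invr_ge0 // ler_nat.
  have st' := ler_wpM2l (ltW n0) st.
  have kd : delta * n%:R * (eta / 2) <= k%:R * (eta / 2).
    by rewrite ler_wpM2r ?(ltW eta2) // ltW.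
  by rewrite /t2; lra.
by lra.
Unshelve. all: by end_near. Qed.

Lemma small_h_limit eps rho eta : 0 < eps -> 0 <= rho <= 1 -> 0 < eta ->
  \forall n \near \oo,
  expR (n%:R * (rate eps (1 - rho) - eta)) <= small_h eps n (n - Num.truncn (rho * n%:R))
    <= expR (n%:R * (rate eps (1 - rho) + eta)).
Proof.
move=> e0 r01 eta0; have /andP[r0 r1] := r01; set x := 1 - rho.
have x01 : 0 <= x <= 1 by rewrite /x; apply/andP; split; lra.
have /andP[x0 x1] := x01.
have eta3 : 0 < eta / 3 by lra.
have hl : rate eps x - eta < rate eps x by lra.
have hlow := lower_rates_lt_rate e0 x01 hl.
near=> n.
have hn : large n by near: n; exact: near_large.
have n0 := large_gt0 hn.
have nz : n%:R != 0 :> R by rewrite lt0r_neq0.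
have en : 1 <= eps * n%:R.
  have : 1 / eps <= n%:R by near: n; exact: nbhs_infty_ger.
  by rewrite ler_pdivrMr // mulrC.
have h1 : expR (n%:R * (rate eps x - eta)) <= small_h eps n (Num.truncn (x * n%:R)) by near: n.
have hup m : (m <= n)%N -> small_h eps n m <= expR (n%:R * (rate eps (m%:R / n%:R) + eta / 3)).
  by move: m; near: n; exact: near_small_h_le_rate.
have x2 : expR (2 * alpha) * n%:R ^+ 2 <= expR (n%:R * (eta / 3)).
  by near: n; exact: near_expR_poly.
have x3 : 3 * (`|1 + ln alpha| + alpha) / eta <= n%:R.
  by near: n; exact: nbhs_infty_ger.
have x4 : 1 <= expR (n%:R * (eta / 3)).
  have h : 0 <= n%:R * (eta / 3) by rewrite mulr_ge0 // ltW.
  by have := expR_ge1Dx (n%:R * (eta / 3)); lra.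
set m := (n - _)%N; set m' := Num.truncn (x * n%:R) in h1.
have lm'n : (m' <= n)%N := truncn_le_n n x01.
have mE : m = m' \/ m = m'.+1.
  have rn0 : 0 <= rho * n%:R by rewrite mulr_ge0.
  have xn0 : 0 <= x * n%:R by rewrite mulr_ge0.
  have := truncnD_or rn0 xn0; rewrite -mulrDl /x subrKC mul1r natrK -/x -/m'.
  rewrite /m; move: (Num.truncn (rho * n%:R)) => a; clear; lia.
have mn : (m <= n)%N by rewrite leq_subr.
apply/andP; split.
  apply: le_trans h1 _; case: mE mn => -> // mn; exact: small_hS_ge.
have z0 j : 0 <= small_h eps n j.
  by apply: hcprob_ge0 => //; [exact: qn_gt0 | exact: qn_le1].
apply: le_trans (_ : expR (n%:R * (eta / 3)) * small_h eps n m' <= _).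
  case: mE mn => -> mn; first by rewrite -[leLHS]mul1r ler_wpM2r.
  by apply: le_trans (small_hS_le _ hn mn) _; rewrite ler_wpM2r.
apply: le_trans (ler_wpM2l (expR_ge0 _) (hup m' lm'n)) _.
rewrite -expRD ler_expR -mulrDr ler_wpM2l //.
set d := x - m'%:R / n%:R.
have xn0 : 0 <= x * n%:R by rewrite mulr_ge0.
have /andP[t1 t2] := truncn_itv xn0; rewrite -/m' in t1 t2.
have d0 : 0 <= d by rewrite subr_ge0 ler_pdivrMr.
have dn : d * n%:R <= 1.
  by rewrite mulrBl divfK //; move: t2; rewrite -natr1; lra.
have de : d <= eps.
  by rewrite -(ler_pM2r n0); apply: le_trans en.
have dx : d <= x by rewrite /d lerBlDr lerDl divr_ge0.
have d1 : d <= 1 := le_trans dx x1.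
have xd : x - d = m'%:R / n%:R by rewrite /d subKr.
(* In place of continuity of [rate], a piece of relative size [d <= 1/n] is removed: [rate_step]
   gives [rate eps (x - d) <= rate eps x - phi d], and by [phi_ge] the loss is of order [1/n]. *)
suff : rate eps (m'%:R / n%:R) <= rate eps x + eta / 3 by lra.
move: d0; rewrite le_eqVlt => /orP[/eqP d0|d0].
  by rewrite -xd -d0 subr0; lra.
have := rate_step e0 x1 d0 de dx; rewrite xd.
have := phi_ge d0.
have ab : - `|1 + ln alpha| <= 1 + ln alpha by rewrite lerNl -normrN ler_norm.
have ab' := ler_wpM2l (ltW d0) ab.
have dd : alpha * d ^+ 2 <= alpha * d.
  by rewrite ler_wpM2l // expr2 -[leRHS]mulr1 ler_wpM2l // ltW.
have ad0 : 0 <= alpha * d by rewrite mulr_ge0 // ltW.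
have : d * (`|1 + ln alpha| + alpha) <= eta / 3.
  rewrite -(ler_pM2r n0) mulrAC.
  apply: le_trans (_ : 1 * (`|1 + ln alpha| + alpha) <= _).
    by rewrite ler_wpM2r // addr_ge0.
  by move: x3; rewrite ler_pdivrMr //; lra.
by lra.
Unshelve. all: by end_near. Qed.

(** * Assembly of the limits *)

(** [gam_bin] absorbs the binomial coefficient and the cross factor, so that the exponential rates
    of the three remaining weights simply add. *)
Lemma Pna_mul_gam eps n k : large n -> (k <= n)%N ->
  @Pna R n alpha (fun E => #|Vset E (eps * n%:R)| == k) * gam (qn n) n%:R n =
  large_h eps n k * small_h eps n (n - k).
Proof.
move=> hn kn; have q0 := qn_gt0 hn.
rewrite Pna_card_Vset -/(qn n) /large_h /small_h /hcprob.
have := @gam_bin R (qn n) q0 n%:R k (n - k); rewrite subnKC // => e.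
transitivity (cprob (qn n) (fun j => eps * n%:R < j%:R) k *
  cprob (qn n) (fun j => j%:R <= eps * n%:R) (n - k) *
  (gam (qn n) n%:R n * ('C(n, k)%:R * qn n ^+ (k * (n - k))))); first by ring.
by rewrite e; ring.
Qed.

Lemma phi0 : phi 0 = 0.
Proof. by rewrite /phi /gfun !mul0r expr0n /= mulr0 mul0r !subr0. Qed.

(** For [0 < rho <= eps] a nonempty union of large components would already exceed [rho n] vertices.
    The cases kept are those that occur as [eps] tends to [0]. *)
Lemma near_large_h_truncn eps rho eta : 0 < eps -> 0 <= rho <= 1 -> rho = 0 \/ eps < rho ->
  0 < eta -> \forall n \near \oo,
  expR (n%:R * (phi rho - eta)) <= large_h eps n (Num.truncn (rho * n%:R))
    <= expR (n%:R * (phi rho + eta)).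
Proof.
move=> e0 r01 re eta0; have /andP[r0 r1] := r01.
case: re => [->|er].
  near=> n; rewrite mul0r truncn0 /large_h.
  have -> : hcprob (qn n) n%:R (fun k => eps * n%:R < k%:R) 0 = 1.
    by rewrite /hcprob cprob0 gam0 mulr1.
  rewrite phi0 sub0r add0r mulrN expR_le1 oppr_le0.
  have h : 0 <= n%:R * eta by rewrite mulr_ge0 // ltW.
  by rewrite h /=; have := expR_ge1Dx (n%:R * eta); lra.
have eta2 : 0 < eta / 2 by lra.
have rho0 : 0 < rho by apply: lt_trans er.
have c1 := cvg_phi rho0 (cvg_truncn_div r0).
near=> n.
have hn : large n by near: n; exact: near_large.
have n0 := large_gt0 hn.
have rn0 : 0 <= rho * n%:R by rewrite mulr_ge0.
have /andP[t1 t2] := truncn_itv rn0.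
have hphi : `|phi rho - phi ((Num.truncn (rho * n%:R))%:R / n%:R)| <= eta / 2.
  by near: n; move/cvgrPdist_le: c1; apply.
have kn := truncn_le_n n r01.
have nr : 1 <= (rho - eps) * n%:R.
  have : 1 / (rho - eps) <= n%:R by near: n; exact: nbhs_infty_ger.
  by rewrite ler_pdivrMr ?subr_gt0 // mulrC.
have hk : eps * n%:R < (Num.truncn (rho * n%:R))%:R.
  by move: t2; rewrite -natr1; lra.
have /andP[h1 h2] : expR (n%:R * (phi ((Num.truncn (rho * n%:R))%:R / n%:R) - eta / 2)) <=
   large_h eps n (Num.truncn (rho * n%:R))
    <= expR (n%:R * (phi ((Num.truncn (rho * n%:R))%:R / n%:R) + eta / 2)).
  move: (Num.truncn (rho * n%:R)) kn hk {t1 t2 hphi}; near: n.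
  exact: near_large_h.
move: hphi; rewrite ler_norml => /andP[hp1 hp2].
apply/andP; split.
  by apply: le_trans h1; rewrite ler_expR ler_wpM2l //; lra.
by apply: le_trans h2 _; rewrite ler_expR ler_wpM2l //; lra.
Unshelve. all: by end_near. Qed.

Lemma cvg_expR_of_bounds (T : Type) (F : set_system T) (FF : ProperFilter F)
    (s : T -> R) (c : R) :
  (forall eta, 0 < eta -> \forall t \near F, expR (c - eta) <= s t <= expR (c + eta)) ->
  s t @[t --> F] --> expR c.
Proof.
move=> h.
have spos : \forall t \near F, 0 < s t.
  near=> t; have /andP[h1 _] : expR (c - 1) <= s t <= expR (c + 1) by near: t; exact: h.
  by apply: lt_le_trans h1; exact: expR_gt0.
have hl : ln (s t) @[t --> F] --> c.
  apply/cvgrPdist_le => e e0; near=> t.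
  have st : 0 < s t by near: t; exact: spos.
  have /andP[h1 h2] : expR (c - e) <= s t <= expR (c + e) by near: t; exact: h.
  have l1 : c - e <= ln (s t) by rewrite -[leLHS]expRK ler_ln ?posrE ?expR_gt0.
  have l2 : ln (s t) <= c + e by rewrite -[leRHS]expRK ler_ln ?posrE ?expR_gt0.
  by rewrite ler_norml; apply/andP; split; lra.
have he : expR (ln (s t)) @[t --> F] --> expR c.
  by apply: continuous_cvg; [exact: continuous_expR | exact: hl].
apply: cvg_trans he; apply: near_eq_cvg; near=> t.
by rewrite lnK // posrE; near: t; exact: spos.
Unshelve. all: by end_near. Qed.

Lemma cvg_seq_eps eps rho : 0 < eps -> 0 <= rho <= 1 -> rho = 0 \/ eps < rho ->
  seq_eps alpha rho eps n @[n --> \oo] -->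
    expR (phi rho + rate eps (1 - rho) + gfun 1).
Proof.
move=> e0 r01 re; have /andP[r0 r1] := r01.
apply: cvg_expR_of_bounds => eta eta0.
have eta3 : 0 < eta / 3 by lra.
near=> n.
have hn : large n by near: n; exact: near_large.
have n0 := large_gt0 hn.
have nz : n%:R != 0 :> R by rewrite lt0r_neq0.
have q0 := qn_gt0 hn; have q1 := qn_le1 hn.
have /andP[a1 a2] : expR (n%:R * (phi rho - eta / 3)) <=
   large_h eps n (Num.truncn (rho * n%:R)) <= expR (n%:R * (phi rho + eta / 3)).
  by near: n; exact: near_large_h_truncn.
have /andP[b1 b2] : expR (n%:R * (rate eps (1 - rho) - eta / 3)) <=
   small_h eps n (n - Num.truncn (rho * n%:R)) <= expR (n%:R * (rate eps (1 - rho) + eta / 3)).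
  by near: n; exact: small_h_limit.
have /andP[c1 c2] : expR (n%:R * (- gfun (n%:R / n%:R) - eta / 3)) <= gam (qn n) n%:R n
    <= expR (n%:R * (- gfun (n%:R / n%:R) + eta / 3)).
  have : forall m, (m <= n)%N -> expR (n%:R * (- gfun (m%:R / n%:R) - eta / 3)) <= gam (qn n) n%:R m
    <= expR (n%:R * (- gfun (m%:R / n%:R) + eta / 3)) by near: n; exact: near_gam.
  by apply.
rewrite divff // in c1 c2.
have kn := truncn_le_n n r01.
rewrite /seq_eps Pna_floor //.
have := Pna_mul_gam eps hn kn.
set P := Pna _ _; set G := gam _ _ _ in c1 c2 *; set LL := large_h _ _ _ in a1 a2 *.
set SS := small_h _ _ _ in b1 b2 *; set c := phi rho + rate eps (1 - rho) + gfun 1.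
move=> PG.
have G0 : 0 < G by apply: gam_gt0.
have P1 : expR (n%:R * (c - eta)) <= P.
  rewrite -(ler_pM2r G0) PG.
  apply: le_trans (ler_wpM2l (expR_ge0 _) c2) _.
  apply: le_trans (ler_pM (expR_ge0 _) (expR_ge0 _) a1 b1).
  by rewrite -!expRD ler_expR -!mulrDr ler_wpM2l // /c; lra.
have P2 : P <= expR (n%:R * (c + eta)).
  rewrite -(ler_pM2r G0) PG.
  apply: le_trans (ler_wpM2l (expR_ge0 _) c1).
  apply: le_trans (ler_pM _ _ a2 b2) _; rewrite ?(le_trans (expR_ge0 _) a1)
    ?(le_trans (expR_ge0 _) b1) //.
  by rewrite -!expRD ler_expR -!mulrDr ler_wpM2l // /c; lra.
have pw (a : R) : expR a = expR (n%:R * a) `^ n%:R^-1.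
  by rewrite -expRM mulrAC divff // mul1r.
have i0 : 0 <= n%:R^-1 :> R by rewrite invr_ge0.
rewrite (pw (c - eta)) (pw (c + eta)); apply/andP; split.
  by apply: ge0_ler_powR => //; rewrite nnegrE ?expR_ge0 // (le_trans (expR_ge0 _) P1).
by apply: ge0_ler_powR => //; rewrite nnegrE ?expR_ge0 // (le_trans (expR_ge0 _) P1).
Unshelve. all: by end_near. Qed.

(** The lower bound holds for every [eps]; for the upper one, any admissible exponent is tested
    against [near_small_h_ub] at a single large [n]. *)
Lemma cvg_rate x : 0 <= x <= 1 -> rate eps x @[eps --> 0^'+] --> psi x - gfun x.
Proof.
move=> x01; have /andP[x0 x1] := x01.
apply/cvgrPdist_le => eta eta0.
have eta2 : 0 < eta / 2 by lra.
have [d0 d00 hd] := near_small_h_ub eta2.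
have c1 := cvg_psi_sub_gfun x0 (cvg_truncn_div x0) (fun e n => truncn_div_eq0 n e).
near=> eps.
have e0 : 0 < eps by near: eps; exact: nbhs_right_gt.
have ed : eps < d0 by near: eps; exact: nbhs_right_lt.
have h1 := rate_ge_psi e0 x01.
suff h2 : rate eps x <= psi x - gfun x + eta.
  by rewrite ler_norml; apply/andP; split; lra.
apply: ge_sup; first by have [] := lower_rates_has_sup e0 x01.
move=> l hl; near \oo => n.
have hn : large n by near: n; exact: near_large.
have n0 := large_gt0 hn.
have a1 : expR (n%:R * l) <= small_h eps n (Num.truncn (x * n%:R)) by near: n; exact: hl.
have mn := truncn_le_n n x01.
have a2 : small_h eps n (Num.truncn (x * n%:R)) <= expR (n%:R *
   (psi ((Num.truncn (x * n%:R))%:R / n%:R) - gfun ((Num.truncn (x * n%:R))%:R / n%:R) + eta / 2)).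
  by move: (Num.truncn (x * n%:R)) mn {a1}; near: n; exact: hd.
have a3 : `|psi x - gfun x - (psi ((Num.truncn (x * n%:R))%:R / n%:R) -
     gfun ((Num.truncn (x * n%:R))%:R / n%:R))| <= eta / 2.
  by near: n; move/cvgrPdist_le: c1; apply.
have := le_trans a1 a2; rewrite ler_expR ler_pM2l //.
by move: a3; rewrite ler_norml => /andP[]; lra.
Unshelve. all: by end_near. Qed.

Lemma psi_Psi x : 0 <= x -> x * Psi (alpha * x) = psi x.
Proof.
have az : alpha != 0 by rewrite lt0r_neq0.
rewrite le_eqVlt => /orP[/eqP <-|x0].
  rewrite mul0r /psi /fcrit mul0r expr0n /= mulr0 mul0r subr0 add0r.
  by rewrite min_r // invr_ge0 mulr_ge0.
rewrite /Psi mulf_eq0 (negPf az) (gt_eqF x0) /= minr_pMr ?(ltW x0) // mulr0.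
rewrite /psi; congr Num.min; rewrite /fcrit.
by field; rewrite az lt0r_neq0.
Qed.

(** The linear parts of [gfun] at [rho], [1 - rho] and [1] cancel; the quadratic parts leave
    [- alpha rho (1 - rho)], which is [(1 - rho) log [1 - pi1 (alpha rho)]]. *)
Lemma expNE_Phi rho : 0 <= rho <= 1 ->
  expNE (Phi rho alpha) = expR (phi rho + (psi (1 - rho) - gfun (1 - rho)) + gfun 1).
Proof.
move=> /andP[r0 r1].
have xl (x : R) : xlnx x = x * ln x.
  by rewrite /xlnx; case: eqP => // ->; rewrite mul0r.
have x1 : xlny rho (pi1 (alpha * rho)) = (rho * ln (pi1 (alpha * rho)))%:E.
  rewrite /xlny; case: eqP => [->|/eqP rn]; first by rewrite mul0r.
  have rp : 0 < rho by rewrite lt_neqAle eq_sym rn.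
  by rewrite gt_eqF // pi1_gt0.
have x2 : xlny (1 - rho) (1 - pi1 (alpha * rho)) = ((1 - rho) * (- (alpha * rho)))%:E.
  rewrite /xlny; case: eqP => [->|_]; first by rewrite mul0r.
  have -> : 1 - pi1 (alpha * rho) = expR (- (alpha * rho)) by rewrite /pi1 subKr.
  by rewrite gt_eqF ?expR_gt0 // expRK.
rewrite /Phi x1 x2 psi_Psi ?subr_ge0 // /Sent !xl /=; congr expR.
by rewrite /phi /gfun ln1; field.
Qed.

End Asymptotics.

(** * The case [alpha = 0]: no edges, all components are single vertices *)

Section Zero.
Variable R : realType.

Lemma cprob_large_q1 (S : pred nat) m : ~~ S 1%N -> cprob (1 : R) S m.+1 = 0.
Proof.
move=> S1; rewrite cprobS big1 // => -[[|k] lk] /= Sk; first by rewrite Sk in S1.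
suff -> : reach_law (1 : R) 1 m k.+1 = 0 by rewrite mul0r.
rewrite /reach_law reachS big1 ?mulr0 ?mul0r // => j _.
by rewrite expr1n subrr expr0n /= mulr0 !mul0r.
Qed.

Lemma cprob_small_q1 (S : pred nat) m : S 1%N -> cprob (1 : R) S m = 1.
Proof.
move=> S1; elim: m => [|m IH]; first by rewrite cprob0.
rewrite cprobS (bigD1 ord0) //= subn0 IH mulr1 big1 ?addr0.
  by rewrite /reach_law bin0 reach0r expr1n !mulr1.
move=> -[[|k] lk] /=; first by rewrite andbF.
move=> _; suff -> : reach_law (1 : R) 1 m k.+1 = 0 by rewrite mul0r.
rewrite /reach_law reachS big1 ?mulr0 ?mul0r // => j _.
by rewrite expr1n subrr expr0n /= mulr0 !mul0r.
Qed.

Lemma seq_eps0 (rho eps : R) n : 0 <= rho <= 1 -> 1 <= eps * n%:R -> (0 < n)%N ->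
  seq_eps 0 rho eps n = (Num.truncn (rho * n%:R) == 0%N)%:R.
Proof.
move=> r01 en n0; have /andP[r0 r1] := r01.
rewrite /seq_eps Pna_floor // Pna_card_Vset mul0r subr0.
have ni : n%:R^-1 != 0 :> R by rewrite invr_neq0 // pnatr_eq0 -lt0n.
case: (Num.truncn _) => [|k] /=.
  rewrite cprob0 cprob_small_q1 ?mulr1 //.
  by rewrite bin0 powR1.
by rewrite cprob_large_q1 -?leNgt // mulr0 mul0r powR0.
Qed.

End Zero.

(** [limn] has a default value for divergent sequences, so convergence in [n] is asserted
    separately, for all small [eps > 0]. *)
Theorem theorem2p1 (R : realType) (alpha rho : R)
  (halpha : 0 <= alpha) (hrho0 : 0 <= rho) (hrho1 : rho <= 1) :
  (\forall eps \near 0^'+, cvgn (seq_eps alpha rho eps)) /\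
  (fun eps => limn (seq_eps alpha rho eps)) x @[x --> 0^'+]
     --> expNE (Phi rho alpha).
Proof.
have r01 : 0 <= rho <= 1 by rewrite hrho0.
have reduce (c : R -> R) :
    (\forall eps \near 0^'+, seq_eps alpha rho eps n @[n --> \oo] --> c eps) ->
    c eps @[eps --> 0^'+] --> expNE (Phi rho alpha) ->
  (\forall eps \near 0^'+, cvgn (seq_eps alpha rho eps)) /\
  (fun eps => limn (seq_eps alpha rho eps)) x @[x --> 0^'+] --> expNE (Phi rho alpha).
  move=> h1 h2; split.
    by apply: filterS h1 => eps h; apply/cvg_ex; exists (c eps).
  apply: cvg_trans h2; apply: near_eq_cvg; apply: filterS h1 => eps h.
  by rewrite (cvg_lim _ h).
move: halpha; rewrite le_eqVlt => /orP[/eqP a0|a0].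
  have reduce0 (b : R) :
    (forall eps, 0 < eps -> \forall n \near \oo, seq_eps alpha rho eps n = b) ->
    expNE (Phi rho alpha) = b ->
    (\forall eps \near 0^'+, cvgn (seq_eps alpha rho eps)) /\
    (fun eps => limn (seq_eps alpha rho eps)) x @[x --> 0^'+] --> expNE (Phi rho alpha).
    move=> h hb; apply: (reduce (fun=> b)); last by rewrite hb; exact: cvg_cst.
    near=> eps; have e0 : 0 < eps by near: eps; exact: nbhs_right_gt.
    by apply: cvg_near_cst; exact: h.
  have pi0 : pi1 (alpha * rho) = 0 by rewrite -a0 mul0r /pi1 oppr0 expR0 subrr.
  have [r0|r0] := eqVneq rho 0.
    apply: (reduce0 1) => [eps e0|]; last first.
      rewrite /Phi pi0 r0 /Sent /xlnx /xlny /Psi eqxx !subr0 oner_eq0 ln1 -a0 !mul0r eqxx.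
      by rewrite !mulr0 add0r !sube0 /= oppr0 expR0.
    near=> n; rewrite -a0 seq_eps0 //.
    by rewrite r0 mul0r truncn0.
    have : 1 / eps <= n%:R by near: n; exact: nbhs_infty_ger.
      by rewrite ler_pdivrMr // mulrC.
    by near: n; exact: nbhs_infty_gt.
  have rp : 0 < rho by rewrite lt_neqAle eq_sym r0.
  apply: (reduce0 0) => [eps e0|]; last first.
    (* [xlny rho 0] is [-oo], so [Phi] is [+oo] and [expNE] returns [0]. *)
    rewrite /Phi pi0 {1}/xlny (negPf r0) eqxx subr0.
    have -> : xlny (1 - rho) 1 = 0%E.
      by rewrite /xlny oner_eq0 ln1 mulr0 if_same.
    by [].
  near=> n; rewrite -a0 seq_eps0 //.
  have n1 : 1 / rho <= n%:R by near: n; exact: nbhs_infty_ger.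
    have : (0 < Num.truncn (rho * n%:R))%N.
      by rewrite truncn_gt0; move: n1; rewrite ler_pdivrMr // mulrC.
    by case: (Num.truncn _).
  have : 1 / eps <= n%:R by near: n; exact: nbhs_infty_ger.
    by rewrite ler_pdivrMr // mulrC.
  by near: n; exact: nbhs_infty_gt.
apply: (reduce (fun eps => expR (phi alpha rho + rate alpha eps (1 - rho) + gfun alpha 1))).
  have [r0|r0] := eqVneq rho 0.
    near=> eps; have e0 : 0 < eps by near: eps; exact: nbhs_right_gt.
    by apply: (cvg_seq_eps a0 e0 r01); left.
  have rp : 0 < rho by rewrite lt_neqAle eq_sym r0.
  near=> eps; have e0 : 0 < eps by near: eps; exact: nbhs_right_gt.
  have er : eps < rho by near: eps; exact: nbhs_right_lt.
  by apply: (cvg_seq_eps a0 e0 r01); right.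
rewrite expNE_Phi //; apply: continuous_cvg; first exact: continuous_expR.
apply: cvgD; last exact: cvg_cst.
apply: cvgD; first exact: cvg_cst.
by apply: cvg_rate => //; rewrite subr_ge0 hrho1 lerBlDr lerDl.
Unshelve. all: by end_near. Qed.
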